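(* Let $\mathcal{X}=[0,1]^d$, and for $\mathbf{x}\in\mathcal{X}$ let the simulation output be $Y(\mathbf{x})=\mu(\mathbf{x})+\epsilon(\mathbf{x})$, where $\mu:\mathcal{X}\to\mathbb{R}$ and $\mathbb{E}[\epsilon(\mathbf{x})]=0$. Suppose that: (1) there is a constant $C_{\mathrm{sg}}$ such that $\mathbb{E}[e^{\lambda\epsilon(\mathbf{x})}]\le e^{\lambda^2C_{\mathrm{sg}}^2/2}$ for all $\lambda\in\mathbb{R}$ and all $\mathbf{x}\in\mathcal{X}$; (2) there is a unique point $\mathbf{x}^*\in\mathcal{X}$ with $\mu(\mathbf{x}^* )=\sup_{\mathbf{x}\in\mathcal{X}}\mu(\mathbf{x})$, and there is a constant $C>0$ such that $\mu(\mathbf{x}^* )-\mu(\mathbf{x})\le C\|\mathbf{x}-\mathbf{x}^*\|$ for all $\mathbf{x}\in\mathcal{X}$; (3) for every $\epsilon>0$ there is $\delta(\epsilon)>0$ such that $\mu(\mathbf{x})<\mu(\mathbf{x}^* )-\delta(\epsilon)$ for all $\mathbf{x}\in\mathcal{X}$ with $\|\mathbf{x}-\mathbf{x}^*\|\ge\epsilon$. Run the Regular Tree Search algorithm (described in the context) with sample budget $N$ and a tree search strategy satisfying the following conditions: - the depth of each leaf (of the tree obtained with budget $N$) is bounded between $h^-(N)$ and $h^+(N)$; - $\lim_{N\to\infty}h^-(N)=\infty$; - $\lim_{N\to\infty}\dfrac{h^+(N)}{f(h^-(N))}=0$, where $f$ is the sample-balance function of the algorithm. Let $L_N^*$ be the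 leaf returned by the algorithm with budget $N$ (the leaf with the largest $\mathcal{I}$-sample mean) and let $\bar{Y}_{L_N^*}$ be its $\mathcal{I}$-sample mean. Then $\bar{Y}_{L_N^*}-\mu(\mathbf{x}^* )$ converges in probability to $0$ as $N\to\infty$.
   Context: $\|\cdot\|$ is the Euclidean norm. Simulating at $\mathbf{x}$ means drawing an independent sample of $Y(\mathbf{x})$. Trees. A tree here is a binary recursive partition of $[0,1]^d$ into axis-aligned hyperrectangles. The root is $[0,1]^d$ and has depth $0$; splitting a node of depth $c$ produces two children of depth $c+1$; leaves are the unsplit nodes. Data. Two disjoint datasets of pairs $(\mathbf{x}_i,Y_i)$ are kept: $\mathbb{S}_{\mathcal{I}}$ (indices $\mathcal{I}$), whose responses are used only to estimate leaf values, and $\mathbb{S}_{\mathcal{J}}$ (indices $\mathcal{J}$), whose responses are used only to decide the splits (''honesty''). For a node $L$, $\bar{Y}_L=\frac{\sum_{i\in\mathcal{I}}\mathbf{1}\{\mathbf{x}_i\in L\}Y_i}{\sum_{i\in\mathcal{I}}\mathbf{1}\{\mathbf{x}_i\in L\}}$. Parameters. $\alpha\in(0,1/2]$, $\kappa\in(0,1]$, $\beta\in(0,1/2)$, a positive function $f(c)$ of the depth $c$, a stage-1 budget $N_0<N$. Splitting criterion for a node $L=\prod_{j=1}^d[r_j^-,r_j^+]$ of depth $c$. A split $(j,z)$ divides $L$ into $L_1=\{\mathbf{x}\in L:\mathbf{x}^{(j)}\le z\}$ and $L_2=\{\mathbf{x}\in L:\mathbf{x}^{(j)}>z\}$. It is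 admissible if $(1-\alpha)r_j^-+\alpha r_j^+\le z\le\alpha r_j^-+(1-\alpha)r_j^+$ and $\#\{i\in\mathcal{I}:\mathbf{x}_i\in L_l\}\ge\beta f(c)$ for $l=1,2$. With probability $\kappa$, a direction $j^*\in\{1,\dots,d\}$ is chosen uniformly at random and $z^*$ minimizes $\sum_{i\in\mathcal{J}}(Y_i-\bar{Y}_1)^2\mathbf{1}\{\mathbf{x}_i\in L_1\}+\sum_{i\in\mathcal{J}}(Y_i-\bar{Y}_2)^2\mathbf{1}\{\mathbf{x}_i\in L_2\}$ over admissible $z$ in direction $j^*$, where $\bar{Y}_1,\bar{Y}_2$ are the mean responses of the $\mathcal{J}$-samples in $L_1,L_2$. Otherwise $(j^*,z^* )$ minimizes the same quantity over all admissible $(j,z)$. Regular Tree. The trees built below by this criterion have these properties. (i) Honest: for each sample $i$, the response $Y_i$ is used only to estimate the value of the leaf or to decide where to place the splits, but not both (responses in $\mathbb{S}_{\mathcal{I}}$ are used only for leaf values, responses in $\mathbb{S}_{\mathcal{J}}$ only for splits). (ii) Random-split: at each step of growth the probability that the next split is along coordinate $j$ is at least $\kappa/d$, for every $j$. (iii) $\alpha$-spatially balanced: after each split, the side length along the split coordinate of each child is at least an $\alpha$ fraction of that of the parent. (iv) $f(c)$-sample balanced: the number of $\mathcal{I}$-samples in a leaf of depth $c$ is between $\beta f(c-1)$ and $f(c)-1$. Regular Tree Search with total budget $N$. Stage 1: sample $N_0$ points uniformly from $\mathcal{X}$, simulate once at each, set $n=N_0$, and divide the data into $\mathbb{S}_{\mathcal{I}}$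 and $\mathbb{S}_{\mathcal{J}}$ of sizes $\lfloor n/2\rfloor$ and $n-\lfloor n/2\rfloor$. Starting from the root, recursively split nodes with the splitting criterion (using the data in the node) until each leaf of depth $c$ contains between $\beta f(c-1)$ and $f(c)-1$ samples of $\mathbb{S}_{\mathcal{I}}$. Let $\mathcal{L}$ be the set of leaves. Stage 2: while $n<N$, do the following. Select a leaf $\hat{L}\in\mathcal{L}$ by the tree search strategy (a rule choosing a current leaf). Sample $\mathbf{x}_{n+1}$ uniformly from $\hat{L}$, simulate there to get $Y_{n+1}$, and add $(\mathbf{x}_{n+1},Y_{n+1})$ to $\mathbb{S}_{\mathcal{I}}$. If the number of $\mathcal{I}$-samples in $\hat{L}$ equals $f(c)$, with $c$ the depth of $\hat{L}$, then: sample $m=\max\{f(c)-\#\{j\in\mathcal{J}:\mathbf{x}_j\in\hat{L}\},0\}$ points uniformly in $\hat{L}$, simulate once at each, add them to $\mathbb{S}_{\mathcal{J}}$, increase $n$ by $m$, split $\hat{L}$ into $L_1,L_2$ by the splitting criterion using the data in $\hat{L}$, and replace $\hat{L}$ in $\mathcal{L}$ by $L_1,L_2$. Then increase $n$ by $1$. Output: $L_N^*=\arg\max_{L\in\mathcal{L}}\bar{Y}_L$ and the optimal value estimate $\bar{Y}_{L_N^*}$.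
   Formalization: The sample-balance function f is assumed nondecreasing (the claim fails for suitable oscillating f), and the algorithm is assumed to find an admissible split whenever it needs one with probability tending to 1 as N→∞, since otherwise its output is undefined. *)

(* Defs.v *)
From HB Require Import structures.
From mathcomp Require Import all_boot all_order all_algebra.
From mathcomp Require Import all_classical all_reals all_analysis.

Set Implicit Arguments.
Unset Strict Implicit.
Unset Printing Implicit Defensive.

Import Order.TTheory GRing.Theory Num.Theory.
Import numFieldNormedType.Exports.

Local Open Scope classical_set_scope.
Local Open Scope ring_scope.

(* Points of R^d are d-tuples, which carry the product (Borel) sigma-algebra. *)
Notation vec R d := (d.-tuple R).

Section Geometry.
Variables (R : realType) (d : nat).

Definition unit_cube : set (vec R d) :=
  [set x | forall j : 'I_d, 0 <= tnth x j <= 1].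

Definition euclid_dist (x y : vec R d) : R :=
  Num.sqrt (\sum_(j < d) (tnth x j - tnth y j) ^+ 2).

Definition set_coord (x : vec R d) (j : 'I_d) (z : R) : vec R d :=
  [tuple (if i == j then z else tnth x i) | i < d].

(* The image of [u] under the affine bijection from the unit cube onto the box
   [lo, hi]; it carries the uniform law to the uniform law. *)
Definition in_box (lo hi u : vec R d) : vec R d :=
  [tuple (tnth lo j + tnth u j * (tnth hi j - tnth lo j)) | j < d].

End Geometry.

Section Objective.
Variables (R : realType) (d : nat).

Definition maximizers (mu : vec R d -> R) : set (vec R d) :=
  [set x | unit_cube x /\ forall y, unit_cube y -> mu y <= mu x].

End Objective.

(* Y(x) = mu x + eps x xi, where xi is drawn from the law Q; a simulation at x
   uses a fresh draw of xi. *)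
Record simulator (R : realType) (d : nat) (dXi : measure_display)
    (Xi : measurableType dXi) := Simulator {
  mean_fun : vec R d -> R ;
  noise : vec R d -> Xi -> R }.

Definition response (R : realType) (d : nat) (dXi : measure_display)
    (Xi : measurableType dXi) (sim : simulator R d Xi) (x : vec R d)
    (xi : Xi) : R :=
  mean_fun sim x + noise sim x xi.

Record tuning (R : realType) := Tuning {
  alpha : R ;
  beta : R ;
  kappa : R ;
  fbal : nat -> nat }.

Definition valid_tuning (R : realType) (th : tuning R) : Prop :=
  [/\ 0 < alpha th <= 2^-1, 0 < beta th < 2^-1, 0 < kappa th <= 1
    & forall c, (0 < fbal th c)%N].

Section Trees.
Variables (R : realType) (d : nat).

(* A node is identified by the sequence of turns leading to it from the root
   ([false] for the child x_j <= z).  [dataI] and [dataJ] are the samples of the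
   two datasets that lie in the node. *)
Record leaf := Leaf {
  addr : seq bool ;
  lo : vec R d ;
  hi : vec R d ;
  dataI : seq (vec R d * R) ;
  dataJ : seq (vec R d * R) }.

Definition depth (L : leaf) : nat := size (addr L).

Definition leaf_mean (L : leaf) : R :=
  (\sum_(s <- dataI L) s.2) / (size (dataI L))%:R.

(* What a split may depend on: everything in the node except the responses of
   the I-samples. *)
Record honest_view := HonestView {
  vaddr : seq bool ;
  vlo : vec R d ;
  vhi : vec R d ;
  vlocI : seq (vec R d) ;
  vdataJ : seq (vec R d * R) }.

Definition view_of (L : leaf) : honest_view :=
  HonestView (addr L) (lo L) (hi L) [seq s.1 | s <- dataI L] (dataJ L).

Definition goes_left (j : 'I_d) (z : R) (x : vec R d) : bool := tnth x j <= z.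
Definition goes_right (j : 'I_d) (z : R) (x : vec R d) : bool := z < tnth x j.

Definition admissible (th : tuning R) (v : honest_view) (j : 'I_d) (z : R) :
    bool :=
  let a := alpha th in
  let r1 := tnth (vlo v) j in
  let r2 := tnth (vhi v) j in
  let t := beta th * (fbal th (size (vaddr v)))%:R in
  [&& (1 - a) * r1 + a * r2 <= z, z <= a * r1 + (1 - a) * r2,
      t <= (count (goes_left j z) (vlocI v))%:R
    & t <= (count (goes_right j z) (vlocI v))%:R].

(* Sum of squared deviations from the mean (0 for the empty sequence). *)
Definition sum_sq_dev (ys : seq R) : R :=
  let m := (\sum_(y <- ys) y) / (size ys)%:R in
  \sum_(y <- ys) (y - m) ^+ 2.

Definition split_cost (v : honest_view) (j : 'I_d) (z : R) : R :=
  sum_sq_dev [seq s.2 | s <- vdataJ v & goes_left j z s.1] +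
  sum_sq_dev [seq s.2 | s <- vdataJ v & goes_right j z s.1].

(* A choice of a minimizer, in a given direction or over all directions; the
   minimizers are not unique. *)
Record minimizer_rule := MinimizerRule {
  best_in_dir : honest_view -> 'I_d -> R ;
  best_overall : honest_view -> 'I_d * R }.

Definition minimizer_rule_correct (th : tuning R) (mr : minimizer_rule) : Prop :=
  (forall v j, (exists z, admissible th v j z) ->
     admissible th v j (best_in_dir mr v j) /\
     forall z, admissible th v j z ->
       split_cost v j (best_in_dir mr v j) <= split_cost v j z) /\
  (forall v, (exists j z, admissible th v j z) ->
     admissible th v (best_overall mr v).1 (best_overall mr v).2 /\
     forall j z, admissible th v j z ->
       split_cost v (best_overall mr v).1 (best_overall mr v).2
         <= split_cost v j z).

(* Measurability of the rule in the box and in the data, for every node address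
   and every number k (resp. l) of I-samples (resp. J-samples). *)
Definition minimizer_rule_measurable (mr : minimizer_rule) : Prop :=
  forall (a : seq bool) (k l : nat),
  let view (p : (vec R d * vec R d) *
                (k.-tuple (vec R d) * l.-tuple (vec R d * R))) :=
    HonestView a p.1.1 p.1.2 (tval p.2.1) (tval p.2.2) in
  [/\ forall j, measurable_fun setT (fun p => best_in_dir mr (view p) j),
      forall j, measurable [set p | (best_overall mr (view p)).1 = j]
    & measurable_fun setT (fun p => (best_overall mr (view p)).2)].

Definition split_at (L : leaf) (j : 'I_d) (z : R) : leaf * leaf :=
  (Leaf (rcons (addr L) false) (lo L) (set_coord (hi L) j z)
     [seq s <- dataI L | goes_left j z s.1]
     [seq s <- dataJ L | goes_left j z s.1],
   Leaf (rcons (addr L) true) (set_coord (lo L) j z) (hi L)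
     [seq s <- dataI L | goes_right j z s.1]
     [seq s <- dataJ L | goes_right j z s.1]).

Record tree_state := TreeState {
  leaves : seq leaf ;
  nsim : nat }.

(* A search strategy sees the past states (most recent first) and a private
   random element, and returns the position of the chosen leaf in [leaves]. *)
Definition strategy (W : Type) := seq tree_state -> W -> nat.

Definition chooses_current_leaf (W : Type) (strat : strategy W) : Prop :=
  forall st past w, (0 < size (leaves st))%N ->
    (strat (st :: past) w < size (leaves st))%N.

Definition best_leaf (L0 : leaf) (Ls : seq leaf) : leaf :=
  foldl (fun b L => if leaf_mean b < leaf_mean L then L else b) L0 Ls.

End Trees.

(* Labels of the samples: the k-th sample of stage 1; the I-sample drawn in stage
   2 in the node of address a when that node already holds k I-samples; the k-th
   J-sample drawn when the node of address a is about to be split. *)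
Inductive draw := Init of nat | DrawI of seq bool & nat | DrawJ of seq bool & nat.

(* All the randomness of a run.  Each draw, and each node split, happens at most
   once in a run and has its own entries of this table, so that every entry is
   fresh (independent of the past) when it is read. *)
Record table (R : realType) (d : nat) (Xi W : Type) := Table {
  unif : draw -> vec R d ;
  seed : draw -> Xi ;
  coin : seq bool -> bool ;
  dir : seq bool -> 'I_d ;
  aux : W }.

Section Algorithm.
Variables (R : realType) (d : nat) (dXi : measure_display).
Variables (Xi : measurableType dXi) (W : Type).
Variables (sim : simulator R d Xi) (th : tuning R) (mr : minimizer_rule R d).
Variable om : table R d Xi W.

Definition sample_in (lo hi : vec R d) (k : draw) : vec R d * R :=
  let x := in_box lo hi (unif om k) in (x, response sim x (seed om k)).

(* [None] when no admissible split exists for the criterion to choose from. *)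
Definition split_leaf (L : leaf R d) : option (leaf R d * leaf R d) :=
  let v := view_of L in
  if coin om (addr L) then
    let j := dir om (addr L) in
    if `[< exists z, admissible th v j z >]
    then Some (split_at L j (best_in_dir mr v j)) else None
  else
    if `[< exists j z, admissible th v j z >]
    then let jz := best_overall mr v in Some (split_at L jz.1 jz.2) else None.

(* Every split strictly decreases the number of I-samples, so the number of
   I-samples of the initial node is enough fuel. *)
Fixpoint grow (fuel : nat) (L : leaf R d) : option (seq (leaf R d)) :=
  if (size (dataI L) < fbal th (depth L))%N then Some [:: L] else
  if fuel is k.+1 then
    if split_leaf L is Some LL then
      if (grow k LL.1, grow k LL.2) is (Some s1, Some s2) then Some (s1 ++ s2)
      else None
    else None
  else None.

Definition root (N0 : nat) (inI : pred nat) : leaf R d :=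
  let lo0 := [tuple (0 : R) | _ < d] in
  let hi0 := [tuple (1 : R) | _ < d] in
  Leaf [::] lo0 hi0
    [seq sample_in lo0 hi0 (Init k) | k <- iota 0 N0 & inI k]
    [seq sample_in lo0 hi0 (Init k) | k <- iota 0 N0 & ~~ inI k].

Definition stage1 (N0 : nat) (inI : pred nat) : option (tree_state R d) :=
  if grow N0 (root N0 inI) is Some Ls then Some (TreeState Ls N0) else None.

Definition stage2_step (st : tree_state R d) (i : nat) :
    option (tree_state R d) :=
  if drop i (leaves st) is L :: rest then
    let others := take i (leaves st) in
    let newI := sample_in (lo L) (hi L) (DrawI (addr L) (size (dataI L))) in
    let L1 := Leaf (addr L) (lo L) (hi L) (rcons (dataI L) newI) (dataJ L) in
    if size (dataI L1) == fbal th (depth L) then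
      let m := (fbal th (depth L) - size (dataJ L))%N in
      let newJ := [seq sample_in (lo L) (hi L) (DrawJ (addr L) k)
                  | k <- iota 0 m] in
      let L2 := Leaf (addr L) (lo L) (hi L) (dataI L1) (dataJ L ++ newJ) in
      if split_leaf L2 is Some LL then
        Some (TreeState (others ++ [:: LL.1; LL.2] ++ rest) (nsim st + m).+1)
      else None
    else Some (TreeState (others ++ L1 :: rest) (nsim st).+1)
  else None.

Fixpoint stage2 (fuel N : nat) (strat : strategy R d W) (st : tree_state R d)
    (past : seq (tree_state R d)) : option (tree_state R d) :=
  if (nsim st < N)%N then
    if fuel is k.+1 then
      if stage2_step st (strat (st :: past) (aux om)) is Some st' then
        stage2 k N strat st' (st :: past)
      else None
    else None
  else Some st.

Definition regular_tree_search (N N0 : nat) (inI : pred nat)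
    (strat : strategy R d W) : option (tree_state R d) :=
  if stage1 N0 inI is Some st then stage2 N N strat st [::] else None.

Definition output_leaf (o : option (tree_state R d)) : option (leaf R d) :=
  if o is Some st then
    if leaves st is L0 :: Ls then Some (best_leaf L0 Ls) else None
  else None.

(* The value 0 on the runs that are not defined is arbitrary. *)
Definition output_estimate (o : option (tree_state R d)) : R :=
  if output_leaf o is Some L then leaf_mean L else 0.

End Algorithm.

Section Probability.
Context {dO : measure_display} {O : measurableType dO} {R : realType}.
Variable P : probability O R.

Definition mutually_independent (I : Type) (G : I -> set (set O)) : Prop :=
  forall (n : nat) (i : 'I_n -> I) (A : 'I_n -> set O),
    injective i -> (forall k, G (i k) (A k)) ->
    P (\bigcap_(k in [set: 'I_n]) A k) = (\prod_(k < n) fine (P (A k)))%:E.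

Definition cvg_in_probability (X : nat -> O -> R) (l : R) : Prop :=
  forall e : R, 0 < e ->
    P [set w | e <= `|X N w - l|] @[N --> \oo] --> 0%E.

End Probability.

Inductive entry (d : nat) :=
  | UnifE of draw & 'I_d | SeedE of draw | CoinE of seq bool | DirE of seq bool
  | AuxE.

Section RandomTable.
Context {dO : measure_display} {O : measurableType dO} {R : realType}.
Variable P : probability O R.
Variables (d : nat) (dXi dW : measure_display).
Variables (Xi : measurableType dXi) (W : measurableType dW).
Variables (Q : probability Xi R) (kap : R) (T : O -> table R d Xi W).

Definition sigma_of_entry (e : entry d) : set (set O) :=
  match e with
  | UnifE k j =>
      preimage_set_system setT (fun w => tnth (unif (T w) k) j) measurable
  | SeedE k => preimage_set_system setT (fun w => seed (T w) k) measurable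
  | CoinE a => preimage_set_system setT (fun w => coin (T w) a) setT
  | DirE a => preimage_set_system setT (fun w => dir (T w) a) setT
  | AuxE => preimage_set_system setT (fun w => aux (T w)) measurable
  end.

(* The uniform variables avoid the null value 0 so that a point drawn in the
   box of a node lies in the node, whose lower faces may be excluded. *)
Record random_table : Prop := RandomTable {
  table_measurable : forall e, sigma_of_entry e `<=` measurable ;
  table_independent : mutually_independent P sigma_of_entry ;
  unif_pos : forall w k j, 0 < tnth (unif (T w) k) j <= 1 ;
  unif_law : forall k j (B : set R), measurable B ->
    P [set w | B (tnth (unif (T w) k) j)] = uniform_prob (@ltr01 R) B ;
  seed_law : forall k (B : set Xi), measurable B ->
    P [set w | B (seed (T w) k)] = Q B ;
  coin_law : forall a, P [set w | coin (T w) a] = kap%:E ;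
  dir_law : forall a j, P [set w | dir (T w) a = j] = (d%:R^-1)%:E }.

End RandomTable.

(* Main.v *)
From HB Require Import structures.
Require Import Defs.
From mathcomp Require Import all_boot all_order all_algebra.
From mathcomp Require Import all_classical all_reals all_analysis.
From mathcomp Require Import measurable_realfun.
From mathcomp Require Import zify ring lra.

Set Implicit Arguments.
Unset Strict Implicit.
Unset Printing Implicit Defensive.

Import Order.TTheory GRing.Theory Num.Theory.
Import numFieldNormedType.Exports.

Local Open Scope classical_set_scope.
Local Open Scope ring_scope.

(** Every sample and every split decision of a run is keyed by a node address, so
    the node at a given address is a function of the random table alone (the
    "virtual tree" [node_at]); the search strategy only decides how far each node
    is filled.  Hence two facts about the virtual tree suffice.

    Noise: by honesty, the I-samples lying in a node are determined by everything
    except the I-seeds, so integrating these seeds out one at a time bounds the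
    exponential moment of the noise of a node holding [k] I-samples, and the
    node mean deviates by more than [e] with probability at most
    [2 exp(- k e^2 / 2c)].  A union bound over the addresses of depth between
    [hmin] and [hmax] and over [k >= beta f(depth - 1)] requires
    [f(h - 1) >= K h] on this range.  For [h > hmin] this is the ratio
    hypothesis.  For [h = hmin] it follows by counting with the budget
    [N' = 2^h - 1]: all leaves are non-empty, so [N'] is too small for depth [h]
    everywhere, while if [f(h - 1) < K h] then the ratio hypothesis forces
    [hmax N' <= h / 2] and trees of that depth cannot absorb [2^h - 1] samples.

    Bias: the coin and the direction at a node are independent of the event that
    the path to the maximizer goes through that node, so the number of splits in
    each direction along the path tends to infinity in probability, and the leaf
    containing the maximizer shrinks to a point. *)

(** * Independence of sigma-algebras generated by disjoint sets of entries *)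

Section Independence.
Context {dO : measure_display} {O : measurableType dO} {R : realType}.
Variables (P : probability O R) (I : eqType) (S : I -> set (set O)).
Hypothesis S_measurable : forall i, S i `<=` measurable.
Hypothesis S_setT : forall i, S i setT.
Hypothesis S_setI : forall i, setI_closed (S i).
Hypothesis S_indep : mutually_independent P S.

Definition sigma_of (E : set I) : set (set O) :=
  <<s \bigcup_(i in E) S i >>.

(** A pi-system generating [sigma_of E]. Its families are indexed by all of [I] and trivial off a
    finite list, so that two of them intersect index by index. *)
Definition finite_meets (E : set I) : set (set O) :=
  [set B | exists s (A : I -> set O), [/\ uniq s, [set` s] `<=` E,
     forall i, S i (A i), forall i, i \notin s -> A i = setT &
     B = \bigcap_i A i]].

Lemma independent_seq (s : seq I) (A : I -> set O) : uniq s ->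
  (forall i, S i (A i)) -> (forall i, i \notin s -> A i = setT) ->
  P (\bigcap_i A i) = (\prod_(i <- s) fine (P (A i)))%:E.
Proof.
move=> us SA sT.
have := S_indep (i := tnth (in_tuple s)) (A := A \o tnth (in_tuple s)).
rewrite big_tnth /= => <-; last 2 first.
- exact/tuple_uniqP.
- by move=> k /=; apply: SA.
- congr (P _); apply/seteqP; split=> w Aw; first by move=> k _; apply: Aw.
  move=> i _; have [si|/sT -> //] := boolP (i \in s).
  have /tnthP[k ->] : i \in in_tuple s by [].
  exact: Aw.
Qed.

Lemma finite_meets_sub (E : set I) : finite_meets E `<=` measurable.
Proof.
move=> _ [s [A [us sE SA sT ->]]].
rewrite (_ : \bigcap_i A i = \bigcap_(i in [set` s]) A i).
  by apply: fin_bigcap_measurable => // i _; apply: S_measurable.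
apply/seteqP; split=> w Aw; first by move=> i _; apply: Aw.
by move=> i _; have [si|/sT -> //] := boolP (i \in s); apply: Aw.
Qed.

Lemma finite_meets_setT (E : set I) : finite_meets E setT.
Proof.
exists [::], (fun=> setT); split=> //.
by apply/seteqP; split.
Qed.

Lemma finite_meets_setI (E : set I) : setI_closed (finite_meets E).
Proof.
move=> _ _ [s [A [us sE SA sT ->]]] [t [B [ut tE SB tT ->]]].
exists (undup (s ++ t)), (fun i => A i `&` B i); split.
- exact: undup_uniq.
- by move=> i; rewrite /= mem_undup mem_cat => /orP[/sE|/tE].
- by move=> i; apply: S_setI.
- move=> i; rewrite mem_undup mem_cat negb_or => /andP[/sT -> /tT ->].
  by rewrite setIT.
- by rewrite bigcapI.
Qed.

Lemma sigma_of_finite_meets (E : set I) : sigma_of E `<=` <<s finite_meets E >>.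
Proof.
apply: smallest_sub; first exact: smallest_sigma_algebra.
move=> B [i Ei SB]; apply: sub_sigma_algebra.
exists [:: i], (fun k => if k == i then B else setT); split=> //.
- by move=> k /=; rewrite inE => /eqP ->.
- by move=> k; case: eqP => [->|].
- by move=> k; rewrite inE => /negbTE ->.
- apply/seteqP; split=> w; last by move=> /(_ i Logic.I); rewrite eqxx.
  by move=> Bw k _; case: eqP.
Qed.

Lemma sigma_of_measurable (E : set I) : sigma_of E `<=` measurable.
Proof.
apply: smallest_sub; first exact: sigma_algebra_measurable.
by move=> B [i _]; apply: S_measurable.
Qed.

Lemma sigma_of_sub (E F : set I) : E `<=` F -> sigma_of E `<=` sigma_of F.
Proof.
move=> EF; apply: sub_sigma_algebra2 => B [i Ei SB]; exists i => //; exact: EF.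
Qed.

(** Pi-lambda argument: as functions of [A], both sides are finite measures, and they agree on the
    pi-system [finite_meets E]. *)
Lemma independent_sigma_of (E : set I) (i : I) (A B : set O) :
  ~ E i -> sigma_of E A -> S i B -> P (A `&` B) = (P A * P B)%E.
Proof.
move=> nEi EA SB; have mB := S_measurable SB.
have PB0 : 0 <= fine (P B) by exact: fine_ge0.
have /= := @g_sigma_algebra_measure_unique _ R O _ (@finite_meets_sub E) (fun=> setT)
  (fun=> finite_meets_setT E) _ (mrestr P mB) (mscale (NngNum PB0) P)
  (@finite_meets_setI E) _ _ A (sigma_of_finite_meets EA).
rewrite /mscale /mrestr /= => ->.
- by rewrite fineK ?fin_num_measure// muleC.
- by rewrite bigcup_const//; exists 0%N.
- move=> _ [s [A' [us sE SA sT ->]]].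
  have nis : i \notin s by apply/negP => /sE.
  (* Since [i \notin s], the slot [i] of the family is free; putting [B] there shows that the meet
     with [B] is again a finite meet, over [i :: s]. *)
  have -> : \bigcap_k A' k `&` B =
      \bigcap_k (if k == i then B else A' k).
    apply/seteqP; split=> w.
      by move=> [Aw Bw] k _; case: eqP => // _; apply: Aw.
    move=> Aw; split; last by have := Aw i Logic.I; rewrite eqxx.
    by move=> k _; have := Aw k Logic.I; case: eqP => // -> _; rewrite sT.
  rewrite (@independent_seq (i :: s)) ?(@independent_seq s)//=.
  + rewrite big_cons eqxx EFinM; congr (_ * (_)%:E)%E.
    apply: eq_big_seq => k ks; case: eqP => // ki.
    by rewrite -ki ks in nis.
  + by rewrite nis.
  + by move=> k; case: eqP => [->|].
  + by move=> k; rewrite inE negb_or => /andP[/negbTE -> /sT ->].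
- move=> _; rewrite setTI; exact: le_lt_trans (probability_le1 _ _) (ltry _).
Qed.

End Independence.

(** * Integrating out an independent variable *)

Section Freezing.
Context {d d1 d2 : measure_display} {O : measurableType d}
  {O1 : measurableType d1} {O2 : measurableType d2} {R : realType}.
Variables (P : probability O R) (Q : probability O2 R).

(** By uniqueness of product measures, the factorization hypothesis says that the law of [(X, Y)] is
    the product of the law of [X] and [Q]; Tonelli does the rest. *)
Lemma integral_independent_pair (X : O -> O1) (Y : O -> O2) (h : (O1 * O2)%type -> \bar R) :
  measurable_fun setT X -> measurable_fun setT Y ->
  (forall A B, measurable A -> measurable B ->
     P (X @^-1` A `&` Y @^-1` B) = (P (X @^-1` A) * Q B)%E) ->
  measurable_fun [set: (O1 * O2)%type] h -> (forall z, 0 <= h z)%E ->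
  (\int[P]_w h (X w, Y w) = \int[P]_w \int[Q]_y h (X w, y))%E.
Proof.
move=> mX mY XY mh h0.
pose X' : {mfun O >-> O1} := HB.pack X (isMeasurableFun.Build _ _ _ _ X mX).
pose XY' : O -> O1 * O2 := fun w => (X w, Y w).
have mXY : measurable_fun setT XY' by exact: measurable_fun_pair.
pose XYm : {mfun O >-> (O1 * O2)%type} :=
  HB.pack XY' (isMeasurableFun.Build _ _ _ _ XY' mXY).
have law A : measurable A -> (distribution P X' \x Q)%E A = distribution P XYm A.
  by apply: product_measure_unique => B C mB mC; exact: (XY B C mB mC).
transitivity (\int[distribution P XYm]_z h z)%E.
  by rewrite ge0_integral_distribution.
transitivity (\int[distribution P X' \x Q]_z h z)%E.
  by apply: eq_measure_integral => A mA _; exact/esym/law.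
rewrite fubini_tonelli1// ge0_integral_distribution//.
- exact: measurable_fun_fubini_tonelli_F.
- by move=> x; apply: integral_ge0 => y _; exact: h0.
Qed.

End Freezing.

(** * The virtual tree *)

HB.instance Definition _ := gen_eqMixin draw.

(** Samples carry the label of their draw instead of a response. Responses are recovered by
    [labelled], and the labels tell which seeds a node depends on. *)
Record vnode (R : realType) (d : nat) := VNode {
  naddr : seq bool ;
  nlo : vec R d ;
  nhi : vec R d ;
  nI : seq (draw * vec R d) ;
  nJ : seq (draw * vec R d) }.

Section VirtualTree.
Context {R : realType} {d : nat} {dXi : measure_display}
  {Xi : measurableType dXi} {W : Type}.
Variables (sim : simulator R d Xi) (th : tuning R) (mr : minimizer_rule R d).
Variables (N0 : nat) (inI : pred nat) (om : table R d Xi W).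
Local Notation vnode := (vnode R d).

Definition labelled (p : draw * vec R d) : vec R d * R :=
  (p.2, response sim p.2 (seed om p.1)).

Definition leaf_of (n : vnode) : leaf R d :=
  Leaf (naddr n) (nlo n) (nhi n) (map labelled (nI n)) (map labelled (nJ n)).

Definition fresh (n : vnode) (k : draw) : draw * vec R d :=
  (k, in_box (nlo n) (nhi n) (unif om k)).

(** The labels continue the count of I-samples already present, as in stage 2. Truncated subtraction
    adds nothing when the node already holds [k] of them. *)
Definition fillI (k : nat) (n : vnode) : vnode :=
  VNode (naddr n) (nlo n) (nhi n)
    (nI n ++ [seq fresh n (DrawI (naddr n) i)
             | i <- iota (size (nI n)) (k - size (nI n))]) (nJ n).

(** The node at the moment it is split. Born with fewer than [k] I-samples, it is split in stage 2,
    once its J-samples are topped up; born with at least [k], it is split in stage 1 with the data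
    it has. *)
Definition fill (n : vnode) : vnode :=
  let k := fbal th (size (naddr n)) in
  VNode (naddr n) (nlo n) (nhi n) (nI (fillI k n))
    (nJ n ++ if (size (nI n) < k)%N then
       [seq fresh n (DrawJ (naddr n) i) | i <- iota 0 (k - size (nJ n))]
     else [::]).

Definition chosen (n : vnode) : 'I_d * R :=
  let v := view_of (leaf_of n) in
  if coin om (naddr n)
  then (dir om (naddr n), best_in_dir mr v (dir om (naddr n)))
  else best_overall mr v.

(* Clamping the cut to the box changes nothing on the runs that are defined, and
   keeps every box of the virtual tree inside the unit cube. *)
Definition cut (n : vnode) : 'I_d * R :=
  let j := (chosen n).1 in
  (j, Num.max (tnth (nlo n) j) (Num.min (tnth (nhi n) j) (chosen n).2)).

Definition side (b : bool) (j : 'I_d) (z : R) (x : vec R d) : bool :=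
  if b then goes_right j z x else goes_left j z x.

Definition halve (n : vnode) (jz : 'I_d * R) (b : bool) : vnode :=
  VNode (rcons (naddr n) b)
    (if b then set_coord (nlo n) jz.1 jz.2 else nlo n)
    (if b then nhi n else set_coord (nhi n) jz.1 jz.2)
    [seq p <- nI n | side b jz.1 jz.2 p.2]
    [seq p <- nJ n | side b jz.1 jz.2 p.2].

Definition vchild (n : vnode) (b : bool) : vnode :=
  halve (fill n) (cut (fill n)) b.

Definition vroot : vnode :=
  let n0 := VNode [::] [tuple (0 : R) | _ < d] [tuple (1 : R) | _ < d]
    [::] [::] in
  VNode [::] (nlo n0) (nhi n0)
    [seq fresh n0 (Init k) | k <- iota 0 N0 & inI k]
    [seq fresh n0 (Init k) | k <- iota 0 N0 & ~~ inI k].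

Definition node_at (a : seq bool) : vnode := foldl vchild vroot a.

Lemma node_at_rcons a b : node_at (rcons a b) = vchild (node_at a) b.
Proof. by rewrite /node_at foldl_rcons. Qed.

Lemma naddr_node_at a : naddr (node_at a) = a.
Proof. by elim/last_ind: a => // a b IH; rewrite node_at_rcons /= IH. Qed.

Lemma root_leaf_of : Defs.root sim om N0 inI = leaf_of vroot.
Proof. by rewrite /Defs.root /leaf_of /= -!map_comp. Qed.

(** Only splits whose direction is forced by the coin are counted: for a fixed [a] the count
    involves coins and directions alone, and it is at most the number of splits along [j] above
    [a]. *)
Definition hits (j : 'I_d) (a : seq bool) : nat :=
  \sum_(i < size a) (coin om (take i a) && (dir om (take i a) == j)).

Lemma hits_rcons j a b :
  hits j (rcons a b) = (hits j a + (coin om a && (dir om a == j)))%N.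
Proof.
rewrite /hits size_rcons big_ord_recr /= -cats1 take_cat ltnn subnn take0 cats0.
congr (_ + _)%N; apply: eq_bigr => i _.
by rewrite takel_cat// ltnW.
Qed.

Definition in_range (lo hi x : vec R d) : Prop :=
  forall i, tnth lo i <= tnth x i <= tnth hi i.

Definition boxed (n : vnode) : Prop :=
  [/\ forall i, 0 <= tnth (nlo n) i, forall i, tnth (nhi n) i <= 1,
      forall i, tnth (nlo n) i <= tnth (nhi n) i,
      forall p, p \in nI n -> in_range (nlo n) (nhi n) p.2 &
      forall p, p \in nJ n -> in_range (nlo n) (nhi n) p.2].

Definition narrow (L : leaf R d) : Prop :=
  forall j, tnth (hi L) j - tnth (lo L) j <= (1 - alpha th) ^+ hits j (addr L).

Variable xstar : vec R d.

Definition turn (n : vnode) : bool :=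
  let jz := cut (fill n) in side true jz.1 jz.2 xstar.

Fixpoint path_to (c : nat) : seq bool :=
  if c is c'.+1 then rcons (path_to c') (turn (node_at (path_to c'))) else [::].

Lemma size_path_to c : size (path_to c) = c.
Proof. by elim: c => //= c IH; rewrite size_rcons IH. Qed.

Hypothesis unif01 : forall k j, 0 <= tnth (unif om k) j <= 1.

Lemma in_box_range (lo hi u : vec R d) : (forall i, tnth lo i <= tnth hi i) ->
  (forall j, 0 <= tnth u j <= 1) -> in_range lo hi (in_box lo hi u).
Proof.
move=> lohi u01 i; rewrite tnth_mktuple.
have := lohi i; have /andP[] := u01 i; move: (tnth u i) (tnth lo i) (tnth hi i).
by move=> v l h *; apply/andP; split; nra.
Qed.

Lemma side_negb b j z x : side (~~ b) j z x = ~~ side b j z x.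
Proof. by case: b; rewrite /side /goes_left /goes_right ltNge ?negbK. Qed.

Lemma boxed_fill n : boxed n -> boxed (fill n).
Proof.
move=> [l0 h1 lh xI xJ]; split=> //= p; rewrite mem_cat => /orP[|].
- exact: xI.
- by move=> /mapP[i _ ->] /=; apply: in_box_range.
- exact: xJ.
- by case: ifP => // _ /mapP[i _ ->] /=; apply: in_box_range.
Qed.

Lemma cut_bounds n : (forall i, tnth (nlo n) i <= tnth (nhi n) i) ->
  tnth (nlo n) (cut n).1 <= (cut n).2 <= tnth (nhi n) (cut n).1.
Proof.
by move=> /(_ (cut n).1) lh; rewrite /= le_max lexx /= ge_max lh ge_min lexx.
Qed.

Lemma halve_range n jz b x : in_range (nlo n) (nhi n) x ->
  side b jz.1 jz.2 x ->
  in_range (nlo (halve n jz b)) (nhi (halve n jz b)) x.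
Proof.
move=> xr sx i; have /andP[xl xh] := xr i.
case: b sx; rewrite /side /goes_left /goes_right => sx /=;
  rewrite tnth_mktuple; case: eqP => [->|_]; rewrite ?xl ?xh ?(ltW sx) ?sx//=.
- by have /andP[] := xr jz.1.
- by have /andP[-> _] := xr jz.1.
Qed.

Lemma boxed_vchild n b : boxed n -> boxed (vchild n b).
Proof.
move=> /boxed_fill bn; have [l0 h1 lh xI xJ] := bn.
have /andP[cl ch] := cut_bounds lh.
split=> [i|i|i|p|p].
- case: b => //=; rewrite tnth_mktuple; case: ifP => // _.
  exact: le_trans cl.
- case: b => //=; rewrite tnth_mktuple; case: ifP => // _.
  exact: le_trans ch _.
- by case: b => /=; rewrite tnth_mktuple; case: eqP => // ->.
- rewrite mem_filter => /andP[sp pI]; apply: halve_range => //; exact: xI.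
- rewrite mem_filter => /andP[sp pI]; apply: halve_range => //; exact: xJ.
Qed.

Lemma boxed_node_at a : boxed (node_at a).
Proof.
elim/last_ind: a => [|a b IH]; last by rewrite node_at_rcons; exact: boxed_vchild.
split=> //= [i|i|i|p|p]; rewrite ?tnth_mktuple ?ler01//.
- move=> /mapP[k _ ->] /=; apply: in_box_range => // i.
  by rewrite !tnth_mktuple ler01.
- move=> /mapP[k _ ->] /=; apply: in_box_range => // i.
  by rewrite !tnth_mktuple ler01.
Qed.

Lemma path_to_range c : unit_cube xstar ->
  in_range (nlo (node_at (path_to c))) (nhi (node_at (path_to c))) xstar.
Proof.
move=> x01; elim: c => [|c IH] /=.
  by move=> i; rewrite !tnth_mktuple; exact: x01.
rewrite node_at_rcons; apply: halve_range => //.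
by rewrite /turn; case: (boolP (side true _ _ _)) => //; rewrite -side_negb.
Qed.

End VirtualTree.

(** * Invariants of a run *)

HB.instance Definition _ (R : realType) (d : nat) := gen_eqMixin (leaf R d).

Section Runs.
Context {R : realType} {d : nat} {dXi : measure_display}
  {Xi : measurableType dXi} {W : Type}.
Variables (sim : simulator R d Xi) (th : tuning R) (mr : minimizer_rule R d).
Variables (N0 : nat) (inI : pred nat) (om : table R d Xi W).
Variable xstar : vec R d.
Hypothesis th_valid : valid_tuning th.
Hypothesis fbal_nondecreasing : {homo fbal th : c c' / (c <= c')%N}.
Hypothesis mr_correct : minimizer_rule_correct th mr.
Hypothesis unif01 : forall k j, 0 <= tnth (unif om k) j <= 1.

Local Notation leaf_of := (leaf_of sim om).
Local Notation node_at := (node_at sim th mr N0 inI om).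
Local Notation fill := (fill th om).
Local Notation cut := (cut sim mr om).
Local Notation path_to := (path_to sim th mr N0 inI om xstar).
Local Notation narrow := (narrow th om).

(** The lower half of the sample balance; writing the depth as a successor exempts the root. *)
Definition fed (L : leaf R d) : Prop :=
  forall c, depth L = c.+1 -> beta th * (fbal th c)%:R <= (size (dataI L))%:R.

Definition on_path (L : leaf R d) : bool := addr L == path_to (depth L).

(** All that the strategy did to a leaf is summarized by its number of I-samples. *)
Definition tracks (L : leaf R d) : Prop :=
  (size (nI (node_at (addr L))) <= size (dataI L))%N /\
  L = leaf_of (fillI om (size (dataI L)) (node_at (addr L))).

Definition born (L : leaf R d) : Prop :=
  [/\ L = leaf_of (node_at (addr L)), fed L & narrow L].

Definition good (L : leaf R d) : Prop :=
  [/\ tracks L, (size (dataI L) < fbal th (depth L))%N, fed L & narrow L].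

(** An admissible cut lies between the faces of the box because [0 < alpha <= 1/2], so clamping
    leaves it unchanged and the actual split is the virtual one. *)
Lemma split_leaf_of n LL : boxed n -> split_leaf th mr om (leaf_of n) = Some LL ->
  [/\ LL = (leaf_of (halve n (cut n) false), leaf_of (halve n (cut n) true)),
      admissible th (view_of (leaf_of n)) (cut n).1 (cut n).2 &
      coin om (naddr n) -> dir om (naddr n) = (cut n).1].
Proof.
move=> [_ _ lh _ _] sL.
have splitE jz : chosen sim mr om n = jz ->
    admissible th (view_of (leaf_of n)) jz.1 jz.2 ->
    split_at (leaf_of n) jz.1 jz.2 =
      (leaf_of (halve n (cut n) false), leaf_of (halve n (cut n) true)) /\
    cut n = jz.
  move=> cn /and4P[/= z1 z2 _ _].
  have [/andP[a0 a1] _ _ _] := th_valid.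
  have := lh jz.1; move: z1 z2; set r1 := tnth (nlo n) jz.1; set r2 := tnth (nhi n) jz.1.
  move=> z1 z2 r12.
  have -> : cut n = jz.
    rewrite /cut cn [RHS]surjective_pairing; congr (_, _).
    rewrite -/r1 -/r2 min_r; last by nra.
    by rewrite max_r//; nra.
  split=> //; rewrite /split_at /leaf_of /= !filter_map.
  by [].
move: sL; rewrite /split_leaf [addr _]/=; case: ifP => cn; case: asboolP => // ex [<-].
- have [adm _] := (mr_correct.1 _ _ ex).
  have [|-> cE] := splitE (dir om (naddr n), best_in_dir mr (view_of (leaf_of n)) (dir om (naddr n))) _ adm.
    by rewrite /chosen cn.
  by split; rewrite ?cE.
- have [adm _] := (mr_correct.2 _ ex).
  have [|-> cE] := splitE (best_overall mr (view_of (leaf_of n))) _ adm.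
    by rewrite /chosen cn.
  by split; rewrite ?cE.
Qed.

(** A cut along [j] leaves at most a fraction [1 - alpha] of side [j] and raises [hits j] by at most
    one. A cut along another direction is no hit for [j], since a successful coin forces the drawn
    direction. *)
Lemma narrow_halve n b : boxed n -> narrow (leaf_of n) ->
  admissible th (view_of (leaf_of n)) (cut n).1 (cut n).2 ->
  (coin om (naddr n) -> dir om (naddr n) = (cut n).1) ->
  narrow (leaf_of (halve n (cut n) b)).
Proof.
move=> [_ _ lh _ _] nn /and4P[/= z1 z2 _ _] cd j.
have [/andP[a0 a1] _ _ _] := th_valid.
have := nn j; have := lh j; rewrite /= hits_rcons.
have a01 : 0 <= 1 - alpha th <= 1 by lra.
have [jc|jc] := eqVneq j (cut n).1; last first.
  have -> : coin om (naddr n) && (dir om (naddr n) == j) = false.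
    by apply/negP => /andP[/cd -> /eqP cj]; move/eqP: jc; apply; exact/esym.
  rewrite addn0; case: b => /=.
    by rewrite tnth_mktuple (negbTE jc).
  by rewrite tnth_mktuple (negbTE jc).
move: z1 z2; rewrite /=; set z := Num.max _ _; rewrite -[(chosen sim mr om n).1]/((cut n).1) -jc.
set r1 := tnth (nlo n) j; set r2 := tnth (nhi n) j => z1 z2 r12 nnj.
(* The cut may be along [j] without a hit; the side shrinks all the same, and the bound to be proved
   is then weaker. *)
have hE : (1 - alpha th) ^+ (hits om j (naddr n)).+1 <=
    (1 - alpha th) ^+ (hits om j (naddr n) + (coin om (naddr n) && (dir om (naddr n) == j))).
  by case: (_ && _); rewrite ?addn1 ?addn0// exprS ler_piMl ?exprn_ge0//; case/andP: a01.
apply: le_trans hE; rewrite exprS.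
have : (1 - alpha th) * (r2 - r1) <= (1 - alpha th) * (1 - alpha th) ^+ hits om j (naddr n).
  by apply: ler_wpM2l => //; case/andP: a01.
move: ((1 - alpha th) * (1 - alpha th) ^+ hits om j (naddr n)) => E rE.
case: b => /=; rewrite tnth_mktuple jc eqxx -jc -/z -/r1 -/r2; lra.
Qed.

Lemma born_split a LL : narrow (leaf_of (fill (node_at a))) ->
  split_leaf th mr om (leaf_of (fill (node_at a))) = Some LL ->
  [/\ born LL.1, born LL.2,
      addr LL.1 = rcons a false /\ addr LL.2 = rcons a true,
      (size (dataI LL.1) + size (dataI LL.2) =
        size (nI (fill (node_at a))))%N &
      a = path_to (size a) -> on_path LL.1 || on_path LL.2].
Proof.
move=> nn; set n := fill (node_at a).
have bn : boxed n by apply: boxed_fill => //; exact: boxed_node_at.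
have na : naddr n = a by rewrite /= naddr_node_at.
have ad b : addr (leaf_of (halve n (cut n) b)) = rcons a b by rewrite /= naddr_node_at.
move=> /(split_leaf_of bn)[-> adm cd].
(* The admissibility thresholds count I-locations of the view, which are the I-samples of the
   children; hence [fed] for both children. *)
have cnt b : count (side b (cut n).1 (cut n).2) (vlocI (view_of (leaf_of n))) =
    size (dataI (leaf_of (halve n (cut n) b))).
  by rewrite /= size_map size_filter -map_comp count_map.
have born_half b : born (leaf_of (halve n (cut n) b)).
  split.
  - by rewrite ad node_at_rcons.
  - move=> c; rewrite /depth ad size_rcons => -[<-].
    rewrite -cnt; have /and4P[_ _ l r] := adm.
    by case: b; rewrite /side; [move: r|move: l]; rewrite /= naddr_node_at.
  - exact: narrow_halve.
split; rewrite ?ad//; [exact: born_half|exact: born_half| |].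
- rewrite -[RHS](count_predC (fun p => side false (cut n).1 (cut n).2 p.2)).
  rewrite 2![size (dataI _)]size_map !size_filter; congr (_ + _)%N.
  by apply: eq_count => p /=; rewrite /goes_right ltNge.
- move=> pa; rewrite /on_path /depth !ad !size_rcons /= -pa.
  by case: (turn _ _ _ _ _ _); rewrite eqxx ?orbT.
Qed.


Lemma fed_gt0 L : fed L -> (0 < depth L)%N -> (0 < size (dataI L))%N.
Proof.
have [_ /andP[b0 _] _ f0] := th_valid.
case E : (depth L) => [//|c] /(_ c E) fc _; rewrite -(ltr0n R).
by apply: lt_le_trans fc; rewrite mulr_gt0// ltr0n.
Qed.

Lemma born_good L : born L -> (size (dataI L) < fbal th (depth L))%N -> good L.
Proof.
move=> [LE fL nL] sL; split=> //.
have sE : size (dataI L) = size (nI (node_at (addr L))) by rewrite {1}LE /= size_map.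
split; rewrite sE//.
by rewrite {1}LE /fillI subnn /= cats0; case: (node_at _).
Qed.

(** A node born with at least [f(c)] I-samples receives no further draw, so a stage 1 split acts on
    [node_at] itself. *)
Lemma fill_full n : (fbal th (size (naddr n)) <= size (nI n))%N -> fill n = n.
Proof.
move=> fn; rewrite /fill /fillI /= ltnNge fn /= cats0.
by rewrite (eqP fn) /= cats0; case: n {fn}.
Qed.

Lemma fill_fillI n : (size (nI n) < fbal th (size (naddr n)))%N ->
  fill n = VNode (naddr n) (nlo n) (nhi n)
    (nI (fillI om (fbal th (size (naddr n))) n))
    (nJ n ++ [seq fresh om n (DrawJ (naddr n) i)
             | i <- iota 0 (fbal th (size (naddr n)) - size (nJ n))]).
Proof. by rewrite /fill => ->. Qed.

(** The second clause is the Kraft equality for the subtree below [L]. *)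
Definition grown (s : seq (leaf R d)) (L : leaf R d) : Prop :=
  [/\ {in s, forall L', good L'},
      \sum_(L' <- s) (2^-1 : R) ^+ depth L' = 2^-1 ^+ depth L,
      (\sum_(L' <- s) size (dataI L'))%N = size (dataI L) &
      on_path L -> has on_path s].

Lemma half_pow (k : nat) : (2^-1 : R) ^+ k.+1 + 2^-1 ^+ k.+1 = 2^-1 ^+ k.
Proof. by rewrite exprS; lra. Qed.

Lemma grown1 L : born L -> (size (dataI L) < fbal th (depth L))%N ->
  grown [:: L] L.
Proof.
move=> bL sL; split; rewrite ?big_seq1//=; last by move=> ->.
by move=> L'; rewrite inE => /eqP ->; exact: born_good.
Qed.

Lemma grow_grown k L s : born L -> grow th mr om k L = Some s -> grown s L.
Proof.
elim: k L s => [|k IH] L s bL; rewrite /=; case: ifPn => sL //.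
- by move=> [<-]; exact: grown1.
- by move=> [<-]; exact: grown1.
have [LE fL nL] := bL.
have fE : fill (node_at (addr L)) = node_at (addr L).
  apply: fill_full; rewrite naddr_node_at.
  by move: sL; rewrite -leqNgt {2}LE /= size_map.
case E : split_leaf => [LL|//].
have bs := @born_split (addr L) LL.
rewrite fE -LE in bs; have [b1 b2 [a1 a2] cnt pth] := bs nL E.
case E1 : grow => [s1|//]; case E2 : grow => [s2|//] [<-].
have [g1 K1 I1 p1] := IH _ _ b1 E1; have [g2 K2 I2 p2] := IH _ _ b2 E2.
split=> [L'| | |].
- by rewrite mem_cat => /orP[/g1|/g2].
- by rewrite big_cat /= K1 K2 /depth a1 a2 !size_rcons half_pow.
- by rewrite big_cat /= I1 I2 cnt [in RHS]LE /= size_map.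
- rewrite has_cat => /eqP/pth/orP[/p1 ->//|/p2 ->]; exact: orbT.
Qed.

(** The last clause bounds the J-draws: stage 1 has at most one more J-sample than I-samples, and a
    split at depth [c] draws at most [f(c)] J-samples while the sum of [f] over the leaves grows by
    [2 f(c+1) - f(c) >= f(c)]. *)
Definition state_ok (st : tree_state R d) : Prop :=
  [/\ {in leaves st, forall L, good L},
      \sum_(L <- leaves st) (2^-1 : R) ^+ depth L = 1,
      has on_path (leaves st),
      (\sum_(L <- leaves st) size (dataI L) <= nsim st)%N &
      (nsim st <= 2 * (\sum_(L <- leaves st) size (dataI L)) + 1 +
        \sum_(L <- leaves st) fbal th (depth L))%N].

Lemma stage1_ok st : count inI (iota 0 N0) = N0./2 ->
  stage1 sim th mr om N0 inI = Some st -> state_ok st /\ nsim st = N0.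
Proof.
move=> half; rewrite /stage1 root_leaf_of.
have br : born (leaf_of (vroot N0 inI om)).
  split=> // j; rewrite /= !tnth_mktuple subr0 /hits big_ord0 expr0//.
case E : grow => [s|//] [<-] /=; split=> //.
have [g K I p] := grow_grown br E.
have sN : size (dataI (leaf_of (vroot N0 inI om))) = N0./2.
  by rewrite /= !size_map size_filter.
split=> //=.
- exact: p.
- by rewrite I sN; lia.
- by rewrite I sN; lia.
Qed.

Lemma stage2_step_ok st st' i : state_ok st ->
  stage2_step sim th mr om st i = Some st' ->
  [/\ state_ok st', (nsim st < nsim st')%N &
    (\sum_(L <- leaves st') size (dataI L) =
      (\sum_(L <- leaves st) size (dataI L)).+1)%N].
Proof.
move=> [g K p sN Ns]; rewrite /stage2_step.
case E : (drop i (leaves st)) => [//|L rest].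
set others := take i (leaves st).
have lE : leaves st = others ++ L :: rest by rewrite -E cat_take_drop.
have [[szL LE] sL fL nL] : good L.
  by apply: g; rewrite lE mem_cat inE eqxx orbT.
set n := node_at (addr L) in szL LE.
have nn : naddr n = addr L by exact: naddr_node_at.
have loE : lo L = nlo n by rewrite LE.
have hiE : hi L = nhi n by rewrite LE.
have dJE : dataJ L = map (labelled sim om) (nJ n) by rewrite LE.
set newI := sample_in _ _ _ _ _.
(* The new sample has the label following those already present, so one more sample of the run is
   one more step of [fillI]. *)
have dIE : rcons (dataI L) newI =
    map (labelled sim om) (nI (fillI om (size (dataI L)).+1 n)).
  rewrite {1}LE /= subSn// -cats1 -addn1 iotaD !map_cat catA; congr (_ ++ _).
  by rewrite /= subnKC// /newI /sample_in loE hiE nn.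
rewrite /= size_rcons.
have goodo : {in others ++ rest, forall L', good L'}.
  move=> L'; rewrite mem_cat => L'in; apply: g; rewrite lE mem_cat inE.
  by case/orP: L'in => ->; rewrite ?orbT.
have pathE : has on_path (others ++ rest) || on_path L.
  move: p; rewrite lE !has_cat /=.
  by case: (has on_path others); case: (on_path L); case: (has on_path rest).
case: ifP => [/eqP full|/negbT nfull]; last first.
  move=> [<-].
  set L1 := Leaf _ _ _ _ _.
  have gL1 : good L1.
    split=> //.
    - split; rewrite /= -/n size_rcons; first exact: leqW.
      by rewrite /L1 dIE loE hiE dJE /leaf_of /= nn.
    - by rewrite /= size_rcons ltn_neqAle nfull.
    - move=> c /fL /le_trans; apply; rewrite /= size_rcons ler_nat; exact: leqnSn.
  have sE : (\sum_(L0 <- others ++ L1 :: rest) size (dataI L0) =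
      (\sum_(L0 <- leaves st) size (dataI L0)).+1)%N.
    by rewrite lE !big_cat !big_cons /= size_rcons; lia.
  split=> //; split=> /=.
  - move=> L'; rewrite mem_cat inE orbCA => /orP[/eqP -> //|L'in].
    by apply: goodo; rewrite mem_cat.
  - by rewrite -[RHS]K lE !big_cat !big_cons.
  - by move: pathE; rewrite !has_cat /= -orbA [_ || on_path L]orbC.
  - by rewrite sE.
  - rewrite sE; have -> : (\sum_(L0 <- others ++ L1 :: rest) fbal th (depth L0) =
      \sum_(L0 <- leaves st) fbal th (depth L0))%N by rewrite lE !big_cat !big_cons.
    lia.
set m := (fbal th (depth L) - size (dataJ L))%N.
set L2 := Leaf _ _ _ _ _.
have fn : (size (nI n) < fbal th (size (naddr n)))%N.
  by rewrite nn -[size (addr L)]/(depth L); exact: leq_ltn_trans sL.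
have eI : dataI L2 = map (labelled sim om)
    (nI (fillI om (fbal th (size (addr L))) n)) by rewrite /L2 [dataI _]/= dIE full.
have eJ : dataJ L2 = map (labelled sim om) (nJ n ++
    [seq fresh om n (DrawJ (addr L) k)
    | k <- iota 0 (fbal th (size (addr L)) - size (nJ n))]).
  rewrite /L2 [dataJ _]/= /m dJE size_map map_cat; congr (_ ++ _).
  by rewrite -map_comp; apply: eq_map => k; rewrite loE hiE.
(* Full and with its J-samples topped up, the leaf is exactly [fill] of its virtual node, whose
   halves are the next virtual nodes. *)
have L2E : L2 = leaf_of (fill n).
  rewrite fill_fillI// nn.
  by transitivity (Leaf (addr L) (nlo n) (nhi n) (dataI L2) (dataJ L2));
    [rewrite -loE -hiE|rewrite eI eJ].
have nL2 : narrow (leaf_of (fill n)).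
  by move=> j; rewrite -L2E; exact: nL.
case El : split_leaf => [LL|//] [<-].
rewrite L2E in El.
have [b1 b2 [a1 a2] cnt pth] := born_split nL2 El.
have cnt' : (size (dataI LL.1) + size (dataI LL.2) = fbal th (depth L))%N.
  rewrite cnt -(size_map (labelled sim om)) -[map _ _]/(dataI (leaf_of (fill n))).
  by rewrite -L2E /L2 /= size_rcons.
have d1 : depth LL.1 = (depth L).+1 by rewrite /depth a1 size_rcons.
have d2 : depth LL.2 = (depth L).+1 by rewrite /depth a2 size_rcons.
have [_ fed1 _] := b1; have [_ fed2 _] := b2.
(* Both children are non-empty and share [f(c)] I-samples, so each holds fewer than
   [f(c) <= f(c+1)]: no child is born full. *)
have s1 : (0 < size (dataI LL.1))%N by apply: fed_gt0; rewrite ?d1.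
have s2 : (0 < size (dataI LL.2))%N by apply: fed_gt0; rewrite ?d2.
have ff := fbal_nondecreasing (leqnSn (depth L)).
have f0 : (0 < fbal th (depth L))%N by have [_ _ _] := th_valid.
have g1 : good LL.1 by apply: born_good => //; rewrite d1; lia.
have g2 : good LL.2 by apply: born_good => //; rewrite d2; lia.
have sE : (\sum_(L0 <- others ++ [:: LL.1, LL.2 & rest]) size (dataI L0) =
      (\sum_(L0 <- leaves st) size (dataI L0)).+1)%N.
  by rewrite lE !big_cat !big_cons /=; lia.
split=> //=; last by lia.
split=> /=.
- move=> L'; rewrite mem_cat !inE.
  case: (eqVneq L' LL.1) => [->//|_]; case: (eqVneq L' LL.2) => [->//|_] /=.
  by move=> L'in; apply: goodo; rewrite mem_cat.
- rewrite -[RHS]K lE !big_cat !big_cons /= d1 d2; congr (_ + _).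
  by rewrite addrA half_pow.
- move: pathE; rewrite !has_cat /= orbC.
  have -> : on_path L = (addr L == path_to (size (addr L))) by [].
  case: eqP => [/pth/orP[->|->]|_] /=; rewrite ?orbT//.
  by move=> /orP[->|->]; rewrite ?orbT.
- by rewrite sE; lia.
- rewrite sE; move: Ns; rewrite lE !big_cat !big_cons /= d1 d2 -/m.
  have : (m <= fbal th (depth L))%N by rewrite /m; lia.
  lia.
Qed.

(** A step is taken only while [nsim < N] and adds a single I-sample, so the I-samples never exceed
    [N], although [nsim] may overshoot it through the J-draws. *)
Lemma stage2_ok N strat fuel st st' past : state_ok st ->
  (\sum_(L <- leaves st) size (dataI L) <= N)%N ->
  stage2 sim th mr om fuel N strat st past = Some st' ->
  [/\ state_ok st', (\sum_(L <- leaves st') size (dataI L) <= N)%N &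
    (N <= nsim st')%N].
Proof.
elim: fuel st past => [|k IH] st past ok sN /=; case: ltnP => // Nst.
- by move=> [<-].
- case E : stage2_step => [st1|//].
  have [ok1 n1 s1] := stage2_step_ok ok E; apply: IH => //.
  by rewrite s1; have [_ _ _ ? _] := ok; lia.
- by move=> [<-].
Qed.

Lemma regular_tree_search_ok N strat st : (N0 <= N)%N ->
  count inI (iota 0 N0) = N0./2 ->
  regular_tree_search sim th mr om N N0 inI strat = Some st ->
  [/\ state_ok st, (\sum_(L <- leaves st) size (dataI L) <= N)%N &
    (N <= nsim st)%N].
Proof.
move=> NN half; rewrite /regular_tree_search; case E : stage1 => [st1|//].
have [ok1 n1] := stage1_ok half E.
apply: stage2_ok => //; have [_ _ _ sn _] := ok1.
by apply: leq_trans sn _; rewrite n1.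
Qed.

End Runs.

(** * Leaf counts and the error of the estimate in a single run *)

Section Consequences.
Context {R : realType} {d : nat} {dXi : measure_display}
  {Xi : measurableType dXi} {W : Type}.
Variables (sim : simulator R d Xi) (th : tuning R) (mr : minimizer_rule R d).
Variables (N0 : nat) (inI : pred nat) (om : table R d Xi W).
Variable xstar : vec R d.
Hypothesis th_valid : valid_tuning th.
Hypothesis fbal_nondecreasing : {homo fbal th : c c' / (c <= c')%N}.
Hypothesis unif01 : forall k j, 0 <= tnth (unif om k) j <= 1.

Local Notation on_path := (on_path sim th mr N0 inI om xstar).
Local Notation good := (good sim th mr N0 inI om).
Local Notation state_ok := (state_ok sim th mr N0 inI om xstar).
Local Notation node_at := (node_at sim th mr N0 inI om).

(** In the Kraft equality every term lies between [2^-h2] and [2^-h1]. *)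
Lemma leaf_count_bounds (s : seq (leaf R d)) (h1 h2 : nat) :
  \sum_(L <- s) (2^-1 : R) ^+ depth L = 1 ->
  {in s, forall L, (h1 <= depth L <= h2)%N} ->
  (2 ^ h1 <= size s <= 2 ^ h2)%N.
Proof.
move=> K dep.
have sumE (h : nat) : \sum_(L <- s) (2^-1 : R) ^+ h = (size s)%:R * 2^-1 ^+ h.
  by rewrite big_const_seq count_predT iter_addr_0 mulr_natl.
have p2 (h : nat) : (0 : R) < 2 ^+ h by rewrite exprn_gt0.
apply/andP; split.
- rewrite -(ler_nat R) natrX -[leLHS]mul1r -ler_pdivlMr ?p2// -exprVn -sumE -[leLHS]K.
  rewrite big_seq [leRHS]big_seq; apply: ler_sum => L /dep/andP[hL _].
  by apply: ler_wiXn2l => //; lra.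
- rewrite -(ler_nat R) natrX -[leRHS]mul1r -ler_pdivrMr ?p2// -exprVn -sumE -[leRHS]K.
  rewrite big_seq [leRHS]big_seq; apply: ler_sum => L /dep/andP[_ hL].
  by apply: ler_wiXn2l => //; lra.
Qed.

(** Relations between the budget and the depth bounds alone. There are at least [2 ^ h1] leaves, all
    non-empty, and at most [2 ^ h2], each with fewer than [f(h2)] I-samples; the factor [3] comes
    from the bound on [nsim]. *)
Lemma state_counts N st h1 h2 : state_ok st ->
  (\sum_(L <- leaves st) size (dataI L) <= N)%N -> (N <= nsim st)%N ->
  {in leaves st, forall L, (h1 <= depth L <= h2)%N} ->
  [/\ (h1 <= h2)%N, (0 < h1 -> 2 ^ h1 <= N)%N &
    (N <= 3 * (2 ^ h2 * fbal th h2) + 1)%N].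
Proof.
move=> [g K p sN Ns] sumN Nn dep.
have /andP[c1 c2] := leaf_count_bounds K dep.
have big_size (F : leaf R d -> nat) (c : nat) :
    {in leaves st, forall L, (F L <= c)%N} ->
    (\sum_(L <- leaves st) F L <= size (leaves st) * c)%N.
  move=> Fc; apply: (@leq_trans (\sum_(L <- leaves st) c)).
    by rewrite big_seq [leqRHS]big_seq; apply: leq_sum.
  by rewrite big_const_seq count_predT iter_addn_0 mulnC.
split.
- by move/hasP: p => [L /dep/andP[+ +] _]; exact: leq_trans.
- move=> h10; apply: leq_trans sumN; apply: leq_trans c1 _.
  rewrite -sum1_size big_seq [leqRHS]big_seq; apply: leq_sum => L Ls.
  have [_ _ fL _] := g L Ls; apply: (fed_gt0 th_valid fL).
  by apply: leq_trans h10 _; have /andP[] := dep L Ls.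
- apply: leq_trans Nn _; apply: leq_trans Ns _.
  have B1 : (\sum_(L <- leaves st) fbal th (depth L) <= size (leaves st) * fbal th h2)%N.
    by apply: big_size => L /dep/andP[_ ?]; exact: fbal_nondecreasing.
  have B2 : (\sum_(L <- leaves st) size (dataI L) <= size (leaves st) * fbal th h2)%N.
    apply: big_size => L Ls; have [_ /ltnW sL _ _] := g L Ls.
    apply: leq_trans sL _; apply: fbal_nondecreasing.
    by have /andP[] := dep L Ls.
  have B3 : (size (leaves st) * fbal th h2 <= 2 ^ h2 * fbal th h2)%N.
    by rewrite leq_mul2r c2 orbT.
  lia.
Qed.

Definition noise_sum (L : leaf R d) : R :=
  \sum_(s <- dataI L) (s.2 - mean_fun sim s.1).

Lemma best_leafP (L0 : leaf R d) Ls :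
  best_leaf L0 Ls \in L0 :: Ls /\
  {in L0 :: Ls, forall L, leaf_mean L <= leaf_mean (best_leaf L0 Ls)}.
Proof.
rewrite /best_leaf; elim: Ls L0 => [|L Ls IH] L0 /=.
  by split=> [|L]; rewrite inE// => /eqP ->.
have [bin bmax] := IH (if leaf_mean L0 < leaf_mean L then L else L0).
split.
  move: bin; rewrite !inE; case: ifP => _ /orP[->|->]; rewrite ?orbT//.
move=> L'; rewrite !inE => L'in.
have [L'E|L's] : L' = L0 \/ (L' = L \/ L' \in Ls).
- by case/orP: L'in => [/eqP ->|/orP[/eqP ->|->]]; auto.
- rewrite L'E; apply: le_trans (bmax _ _); last exact: mem_head.
  by case: ltP => [/ltW|].
case: L's => [->|L's]; last by apply: bmax; rewrite inE L's orbT.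
apply: le_trans (bmax _ _); last exact: mem_head.
by case: ltP.
Qed.

Lemma good_range L : good L -> forall s, s \in dataI L ->
  in_range (lo L) (hi L) s.1 /\ unit_cube s.1.
Proof.
move=> [[_ ->] _ _ _] s; set n := node_at _ => /=.
have [l0 h1 lh xI _] : boxed n by exact: boxed_node_at.
move=> /mapP[p pin ->] /=.
have r : in_range (nlo n) (nhi n) p.2.
  move: pin; rewrite mem_cat => /orP[/xI//|/mapP[i _ ->]] /=.
  exact: in_box_range.
split=> // j; have /andP[a b] := r j.
by rewrite (le_trans (l0 j) a) (le_trans b (h1 j)).
Qed.

(** Through the l1 norm, whose square dominates the sum of squares. *)
Lemma euclid_dist_le (x y : vec R d) (e : R) :
  (forall j, `|tnth x j - tnth y j| <= e) -> euclid_dist x y <= d%:R * e.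
Proof.
move=> xy.
have -> : d%:R * e = \sum_(j < d) e by rewrite sumr_const card_ord mulr_natl.
apply: le_trans (_ : \sum_(j < d) `|tnth x j - tnth y j| <= _); last exact: ler_sum.
rewrite /euclid_dist -[leRHS]ger0_norm ?sumr_ge0// -sqrtr_sqr ler_sqrt ?sqr_ge0//.
set r := \sum_(j < d) `|_|.
suff [] : 0 <= r /\ \sum_(j < d) (tnth x j - tnth y j) ^+ 2 <= r ^+ 2 by [].
rewrite /r; elim/big_rec2: _ => [|j a b _ [a0 ba]]; first by rewrite expr0n.
have n0 := normr_ge0 (tnth x j - tnth y j).
have nn : `|tnth x j - tnth y j| ^+ 2 = (tnth x j - tnth y j) ^+ 2.
  by rewrite -normrX ger0_norm ?sqr_ge0.
by rewrite addr_ge0//; split=> //; rewrite -nn sqrrD; nra.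
Qed.

Lemma leaf_mean_decomp L : leaf_mean L =
  (\sum_(s <- dataI L) mean_fun sim s.1 + noise_sum L) / (size (dataI L))%:R.
Proof.
rewrite /leaf_mean /noise_sum sumrB addrC subrK//.
Qed.

(** From above, the mean function never exceeds its maximum, so a leaf mean can do so only by its
    noise. From below, the best leaf is at least as good as the leaf on the path, all of whose
    samples are within [d * eta] of the maximizer. *)
Lemma estimate_close st (e eta C : R) : state_ok st ->
  {in leaves st, forall L, 0 < depth L}%N ->
  unit_cube xstar -> (forall x, unit_cube x -> mean_fun sim x <= mean_fun sim xstar) ->
  0 <= C -> (forall x, unit_cube x ->
    mean_fun sim xstar - mean_fun sim x <= C * euclid_dist x xstar) ->
  {in leaves st, forall L, `|noise_sum L| <= e * (size (dataI L))%:R} ->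
  {in leaves st, forall L, on_path L -> forall j,
     tnth (hi L) j - tnth (lo L) j <= eta} ->
  `|output_estimate (Some st) - mean_fun sim xstar| <= e + C * (d%:R * eta).
Proof.
move=> [g K p sN Ns] dep x01 xmax C0 lip small_noise thin.
rewrite /output_estimate /=.
case E : (leaves st) => [|L0 Ls]; first by rewrite E in p.
have [bin bmax] := best_leafP L0 Ls; rewrite -E in bin bmax.
set B := best_leaf L0 Ls in bin bmax *.
have size_gt0 L : L \in leaves st -> (0 : R) < (size (dataI L))%:R.
  move=> Ls'; rewrite ltr0n; have [_ _ fL _] := g L Ls'.
  by apply: (fed_gt0 th_valid fL); exact: dep.
have big_const L (c : R) : \sum_(s <- dataI L) c = c * (size (dataI L))%:R.
  by rewrite big_const_seq count_predT iter_addr_0 mulr_natr.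
have upper : leaf_mean B <= mean_fun sim xstar + e.
  rewrite leaf_mean_decomp ler_pdivrMr ?size_gt0// mulrDl; apply: lerD.
    rewrite -big_const big_seq [leRHS]big_seq; apply: ler_sum => s sB.
    by apply: xmax; have [] := good_range (g _ bin) sB.
  exact: le_trans (ler_norm _) (small_noise _ bin).
(* The upper bound needs a nonnegative bias term; for [d > 0] the box of the leaf on the path gives
   [0 <= eta]. *)
have eta0 : 0 <= C * (d%:R * eta).
  have [->|dn0] := eqVneq d 0%N; first by rewrite mul0r mulr0.
  rewrite !mulr_ge0//; have /hasP[L Lin Lp] := p.
  have j0 : 'I_d by apply: (@Ordinal _ 0); rewrite lt0n.
  apply: le_trans (thin L Lin Lp j0); rewrite subr_ge0.
  have [[_ ->] _ _ _] := g L Lin.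
  by have [_ _ lh _ _] := boxed_node_at sim th mr N0 inI unif01 (addr L); apply: lh.
have lower : mean_fun sim xstar - (e + C * (d%:R * eta)) <= leaf_mean B.
  have /hasP[L Lin Lp] := p; apply: le_trans (bmax _ Lin).
  rewrite leaf_mean_decomp ler_pdivlMr ?size_gt0// opprD addrCA addrC mulrDl; apply: lerD.
    rewrite -big_const big_seq [leRHS]big_seq; apply: ler_sum => s sL.
    have [sr s01] := good_range (g _ Lin) sL.
    rewrite lerBlDr -lerBlDl; apply: le_trans (lip _ s01) _.
    apply: ler_wpM2l => //; apply: euclid_dist_le => j.
    have : in_range (lo L) (hi L) xstar.
      have [[_ ->] _ _ _] := g L Lin; move: Lp => /eqP ->.
      exact: path_to_range.
    move=> /(_ j); have := sr j; have := thin L Lin Lp j.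
    by move=> *; rewrite ler_norml; lra.
  by rewrite mulNr lerNl; apply: le_trans (small_noise _ Lin); rewrite -normrN ler_norm.
by rewrite ler_norml; lra.
Qed.

End Consequences.

(** * Measurability of the virtual tree *)

Section DiscreteMeasurability.
Context {dO : measure_display} {O : measurableType dO}.

(** Measurability into the discrete sigma-algebra, for targets such as ordinals, numbers and lists
    of booleans. *)
Definition dmeasurable (C : Type) (F : O -> C) : Prop :=
  forall A : set C, measurable (F @^-1` A).

Lemma dmeasurable_eq (C : Type) (F G : O -> C) : F =1 G ->
  dmeasurable F -> dmeasurable G.
Proof. by move=> /funext ->. Qed.

Lemma measurable_fun_eq {d' : measure_display} {X : measurableType d'}
  (F G : O -> X) : F =1 G -> measurable_fun setT F -> measurable_fun setT G.
Proof. by move=> /funext ->. Qed.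

Lemma dmeasurable_cst (C : Type) (c : C) : dmeasurable (fun=> c).
Proof. by move=> A; rewrite preimage_cst; case: ifP. Qed.

Lemma dmeasurable_comp (C C' : Type) (g : C -> C') (F : O -> C) :
  dmeasurable F -> dmeasurable (fun w => g (F w)).
Proof. by move=> mF A; exact: (mF (g @^-1` A)). Qed.

(** Cuts the space into the countably many events [F = c], on each of which the index is
    constant. *)
Lemma dmeasurable_select {d' : measure_display} {X : measurableType d'}
    (C : countType) (F : O -> C) (f : C -> O -> X) :
  dmeasurable F -> (forall c, measurable_fun setT (f c)) ->
  measurable_fun setT (fun w => f (F w) w).
Proof.
move=> mF mf _ B mB; rewrite setTI.
rewrite (_ : _ @^-1` _ = \bigcup_c (F @^-1` [set c] `&` f c @^-1` B)).
  apply: countable_bigcupT_measurable; first exact: countableP.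
  by move=> c; apply: measurableI; [exact: mF|rewrite -[X in measurable X]setTI; exact: mf].
by apply/seteqP; split=> [w Bw|w [c _ [<-]]//]; exists (F w).
Qed.

Lemma dmeasurable_select_discrete (C : countType) (C' : Type) (F : O -> C)
    (f : C -> O -> C') :
  dmeasurable F -> (forall c, dmeasurable (f c)) ->
  dmeasurable (fun w => f (F w) w).
Proof.
move=> mF mf B.
rewrite (_ : _ @^-1` _ = \bigcup_c (F @^-1` [set c] `&` f c @^-1` B)).
  apply: countable_bigcupT_measurable; first exact: countableP.
  by move=> c; apply: measurableI; [exact: mF|exact: mf].
by apply/seteqP; split=> [w Bw|w [c _ [<-]]//]; exists (F w).
Qed.

Lemma dmeasurable2 (C1 : countType) (C2 C3 : Type) (g : C1 -> C2 -> C3)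
    (F : O -> C1) (G : O -> C2) :
  dmeasurable F -> dmeasurable G -> dmeasurable (fun w => g (F w) (G w)).
Proof.
move=> mF mG; apply: (@dmeasurable_select_discrete _ _ F (fun c w => g c (G w))) => // c.
exact: dmeasurable_comp.
Qed.

Lemma dmeasurable_bool (F : O -> bool) : measurable_fun setT F -> dmeasurable F.
Proof. by move=> mF A; rewrite -[X in measurable X]setTI; exact: mF. Qed.

Lemma dmeasurable_countable (C : countType) (F : O -> C) :
  (forall c, measurable (F @^-1` [set c])) -> dmeasurable F.
Proof.
move=> mF A.
rewrite (_ : _ @^-1` _ = \bigcup_c (if c \in A then F @^-1` [set c] else set0)).
  apply: countable_bigcupT_measurable; first exact: countableP.
  by move=> c; case: ifP.
apply/seteqP; split=> [w Aw|w [c _]]; first by exists (F w); rewrite ?mem_set.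
by case: ifPn => // cA wc; move: (set_mem cA); rewrite -wc.
Qed.

End DiscreteMeasurability.

(** * Encoding of the random data of a node *)

Definition is_I_draw (inI : pred nat) (k : draw) : bool :=
  match k with Init i => inI i | DrawI _ _ => true | DrawJ _ _ => false end.

(** Comparing lengths is enough to make the labels [DrawI a i] new when node [a] is filled. *)
Definition older_than (a : seq bool) (k : draw) : bool :=
  if k is DrawI b _ then (size b < size a)%N else true.

(* The list-valued data of a node are encoded by a fixed list of draws, each with
   a random indicator of its presence and a random location. *)
Record item (O : Type) (R : realType) (d : nat) := Item {
  lab : draw ; sel : O -> bool ; loc : O -> vec R d }.
Arguments lab {O R d}.

HB.instance Definition _ (O : Type) (R : realType) (d : nat) :=
  gen_eqMixin (item O R d).

Definition items_at (O : Type) (R : realType) (d : nat) (l : seq (item O R d))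
    (w : O) : seq (draw * vec R d) :=
  [seq (lab i, loc i w) | i <- l & sel i w].

(** * Measurability of the nodes and of the path to a point *)

Section NodeMeasurability.
Context {R : realType} {d : nat} {dXi : measure_display}
  {Xi : measurableType dXi} {W : Type}.
Variables (sim : simulator R d Xi) (th : tuning R) (mr : minimizer_rule R d).
Hypothesis mean_meas : measurable_fun (@unit_cube R d) (mean_fun sim).
Hypothesis noise_meas : measurable_fun (@unit_cube R d `*` setT)
  (fun p : vec R d * Xi => noise sim p.1 p.2).
Hypothesis mr_meas : minimizer_rule_measurable mr.
Variables (N0 : nat) (inI : pred nat).
Context {dO : measure_display} {O : measurableType dO}.
Variable T : O -> table R d Xi W.
Hypothesis unif01 : forall w k j, 0 <= tnth (unif (T w) k) j <= 1.
Hypothesis unif_meas : forall k j,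
  measurable_fun setT (fun w => tnth (unif (T w) k) j).
Hypothesis seed_meas : forall k, ~~ is_I_draw inI k ->
  measurable_fun setT (fun w => seed (T w) k).

Local Notation item := (item O R d).

Definition item_ok (i : item) : Prop :=
  [/\ dmeasurable (sel i), measurable_fun setT (loc i) &
      forall w, unit_cube (loc i w)].

Definition items_ok (l : seq item) : Prop := {in l, forall i, item_ok i}.

Definition represents (l : seq item) (F : O -> seq (draw * vec R d)) : Prop :=
  items_ok l /\ forall w, F w = items_at l w.

(** The last clause is honesty: no I-draw occurs among the J-samples, so the responses read by the
    splits involve only seeds covered by [seed_meas]. *)
Definition node_ok (a : seq bool) (n : O -> vnode R d) (lI lJ : seq item) : Prop :=
  [/\ forall w, naddr (n w) = a /\ boxed (n w),
      measurable_fun setT (fun w => nlo (n w)) /\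
      measurable_fun setT (fun w => nhi (n w)),
      represents lI (fun w => nI (n w)), represents lJ (fun w => nJ (n w)) &
      {in lJ, forall i, ~~ is_I_draw inI (lab i)}].

(** With distinct labels, each I-seed enters the noise of a node at most once, and the seeds can be
    integrated out separately. *)
Definition labels_ok (a : seq bool) (lI : seq item) : Prop :=
  uniq (map lab lI) /\
  {in lI, forall i, is_I_draw inI (lab i) && older_than a (lab i)}.

Lemma unit_cube_measurable : measurable (@unit_cube R d).
Proof.
rewrite (_ : @unit_cube R d = \bigcap_(j in [set: 'I_d])
    ((fun x => tnth x j) @^-1` `[0, 1])); last first.
  by apply/seteqP; split=> x /= x01 j => [_|]; have := x01 j; rewrite /= in_itv /=; auto.
apply: fin_bigcap_measurable => // j _.
by rewrite -[X in measurable X]setTI; exact: measurable_tnth.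
Qed.

Lemma represents_pattern l F : represents l F ->
  dmeasurable (fun w => [seq sel i w | i <- l]).
Proof.
move=> [ok _]; elim: l ok => [|i l IH] ok /=; first exact: dmeasurable_cst.
apply: (@dmeasurable2 _ _ _ _ _ cons).
  by have [] := ok i (mem_head _ _).
by apply: IH => j jl; apply: ok; rewrite inE jl orbT.
Qed.

Lemma represents_size l F : represents l F -> dmeasurable (fun w => size (F w)).
Proof.
move=> rF; have := dmeasurable_comp (count id) (represents_pattern rF).
congr dmeasurable; apply/funext => w.
by rewrite rF.2 /items_at size_map size_filter count_map; apply: eq_count.
Qed.

Lemma represents_cat l1 l2 F1 F2 : represents l1 F1 -> represents l2 F2 ->
  represents (l1 ++ l2) (fun w => F1 w ++ F2 w).
Proof.
move=> [ok1 e1] [ok2 e2]; split.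
  by move=> i; rewrite mem_cat => /orP[/ok1|/ok2].
by move=> w; rewrite e1 e2 /items_at filter_cat map_cat.
Qed.

Lemma dmeasurable_side b (J : O -> 'I_d) (Z : O -> R) (X : O -> vec R d) :
  dmeasurable J -> measurable_fun setT Z -> measurable_fun setT X ->
  dmeasurable (fun w => side b (J w) (Z w) (X w)).
Proof.
move=> mJ mZ mX.
apply: (@dmeasurable_select_discrete _ _ _ _ _ (fun j w => side b j (Z w) (X w))) => // j.
have mXj : measurable_fun setT (fun w => tnth (X w) j).
  exact: measurableT_comp (measurable_tnth _) mX.
apply: dmeasurable_bool; rewrite /side; case: b.
  rewrite /goes_right; under eq_fun do rewrite ltNge.
  exact/measurable_neg/measurable_fun_ler.
exact: measurable_fun_ler.
Qed.

(** Filtering keeps the candidate draws and only shrinks their indicators. *)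
Lemma represents_side b (J : O -> 'I_d) (Z : O -> R) l F :
  dmeasurable J -> measurable_fun setT Z -> represents l F ->
  represents [seq Item (lab i) (fun w => sel i w && side b (J w) (Z w) (loc i w)) (loc i)
             | i <- l]
    (fun w => [seq p <- F w | side b (J w) (Z w) p.2]).
Proof.
move=> mJ mZ [ok e]; split.
  move=> _ /mapP[i /ok [s m c] ->]; split=> //=.
  by apply: (@dmeasurable2 _ _ _ _ _ andb) => //; exact: dmeasurable_side.
move=> w; rewrite e /items_at filter_map -filter_predI.
rewrite [in RHS]filter_map -map_comp.
by congr map; apply: eq_filter => i /=; rewrite andbC.
Qed.

Lemma in_box_measurable (lo hi U : O -> vec R d) : measurable_fun setT lo ->
  measurable_fun setT hi -> (forall j, measurable_fun setT (fun w => tnth (U w) j)) ->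
  measurable_fun setT (fun w => in_box (lo w) (hi w) (U w)).
Proof.
move=> mlo mhi mU; apply/measurable_fun_tnthP => j.
rewrite (_ : _ \o _ = fun w => tnth (lo w) j + tnth (U w) j * (tnth (hi w) j - tnth (lo w) j)).
  have ml := measurableT_comp (measurable_tnth j) mlo.
  have mh := measurableT_comp (measurable_tnth j) mhi.
  apply: measurable_funD => //; apply: measurable_funM => //.
  exact: measurable_funB.
by apply/funext => w /=; rewrite tnth_mktuple.
Qed.

Lemma boxed_cube (n : vnode R d) (x : vec R d) : boxed n -> in_range (nlo n) (nhi n) x -> unit_cube x.
Proof.
move=> [l0 h1 _ _ _] r j; have /andP[a b] := r j.
by rewrite (le_trans (l0 j) a) (le_trans b (h1 j)).
Qed.

Lemma fresh_item_ok a n lI lJ (s : O -> bool) k : node_ok a n lI lJ -> dmeasurable s ->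
  item_ok (Item k s (fun w => (fresh (T w) (n w) k).2)).
Proof.
move=> [an [mlo mhi] _ _ _] ms; split=> //=; first exact: in_box_measurable.
move=> w; have [_ bn] := an w; apply: (boxed_cube bn).
by apply: in_box_range => //; have [] := bn.
Qed.

Lemma filter_iota_geq m k : [seq i <- iota 0 k | (m <= i)%N] = iota m (k - m).
Proof.
elim: k => [|k IH]; first by [].
rewrite -addn1 iotaD filter_cat IH add0n /=; case: leqP => mk.
  by rewrite addn1 subSn// -[in RHS]addn1 iotaD subnKC.
by rewrite cats0; congr iota; lia.
Qed.

Lemma filter_iota_ltn m k : [seq i <- iota 0 k | (i < m)%N] = iota 0 (minn m k).
Proof.
elim: k => [|k IH]; first by rewrite minn0.
rewrite -addn1 iotaD filter_cat IH add0n /=; case: ltnP => mk.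
  by rewrite (minn_idPr _) ?(minn_idPr (_ : k + 1 <= m)%N) ?iotaD ?add0n//; lia.
by rewrite cats0; congr iota; lia.
Qed.

Lemma represents_fillI a n lI lJ k : node_ok a n lI lJ ->
  represents (lI ++ [seq Item (DrawI a i) (fun w => size (nI (n w)) <= i)%N
      (fun w => (fresh (T w) (n w) (DrawI a i)).2) | i <- iota 0 k])
    (fun w => nI (fillI (T w) k (n w))).
Proof.
move=> ok; have [an _ rI _ _] := ok; apply: represents_cat => //; split.
  move=> _ /mapP[i _ ->]; apply: (fresh_item_ok _ ok).
  exact: (dmeasurable_comp (fun m => m <= i)%N (represents_size rI)).
move=> w; rewrite /items_at filter_map -map_comp /= -filter_iota_geq.
by have [-> _] := an w.
Qed.

Lemma labels_ok_cat a b lI k (s : nat -> O -> bool) (x : nat -> O -> vec R d) :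
  labels_ok a lI ->
  labels_ok (rcons a b) (lI ++ [seq Item (DrawI a i) (s i) (x i) | i <- iota 0 k]).
Proof.
move=> [u old]; split.
  rewrite map_cat cat_uniq u /= -map_comp map_inj_uniq ?iota_uniq ?andbT; last first.
    by move=> i j [].
  apply/hasPn => _ /mapP[j _ ->]; apply/negP => /mapP[i il iE].
  by have /andP[_] := old i il; rewrite -iE /= ltnn.
move=> i; rewrite mem_cat => /orP[/old/andP[-> ]|/mapP[j _ ->]].
  by case: (lab i) => //= a' _; rewrite size_rcons => /leqW.
by rewrite /= size_rcons ltnSn.
Qed.

(** Once the two presence patterns are fixed, the view is built on tuples of constant lengths, where
    [g] is assumed measurable; there are countably many patterns. *)
Lemma node_ok_view a n lI lJ d' (Y : measurableType d')
    (g : honest_view R d -> Y) : node_ok a n lI lJ ->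
  (forall k l, measurable_fun setT (fun p : (vec R d * vec R d) *
      (k.-tuple (vec R d) * l.-tuple (vec R d * R)) =>
    g (HonestView a p.1.1 p.1.2 (tval p.2.1) (tval p.2.2)))) ->
  measurable_fun setT (fun w => g (view_of (leaf_of sim (T w) (n w)))).
Proof.
move=> [an [mlo mhi] rI rJ nJ] mg.
have mM := dmeasurable2 pair (represents_pattern rI) (represents_pattern rJ).
pose resp w (i : item) := labelled sim (T w) (lab i, loc i w).
pose f (m : seq bool * seq bool) w := g (HonestView a (nlo (n w)) (nhi (n w))
  (map_tuple (fun i : item => loc i w) (in_tuple (mask m.1 lI)))
  (map_tuple (resp w) (in_tuple (mask m.2 lJ)))).
apply: (measurable_fun_eq _ (@dmeasurable_select _ _ _ _ _ _ f mM _)).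
  move=> w; rewrite /f; congr g; rewrite /view_of /= (an w).1 rI.2 rJ.2 /items_at.
  by rewrite -!filter_mask -!map_comp.
move=> m; rewrite /f.
pose tI w := map_tuple (fun i : item => loc i w) (in_tuple (mask m.1 lI)).
pose tJ w := map_tuple (resp w) (in_tuple (mask m.2 lJ)).
suff mv : measurable_fun setT (fun w => ((nlo (n w), nhi (n w)), (tI w, tJ w))).
  exact: (measurableT_comp (mg _ _) mv).
apply: measurable_fun_pair; first exact: measurable_fun_pair.
apply: measurable_fun_pair; apply/measurable_fun_tnthP => i.
  rewrite (_ : _ \o _ = loc (tnth (in_tuple (mask m.1 lI)) i)).
    have /mem_mask il := mem_tnth i (in_tuple (mask m.1 lI)).
    by have [] := rI.1 _ il.
  by apply/funext => w /=; rewrite tnth_map.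
set it := tnth (in_tuple (mask m.2 lJ)) i.
have /mem_mask il : it \in mask m.2 lJ := mem_tnth i (in_tuple (mask m.2 lJ)).
have [_ ml cl] := rJ.1 _ il.
rewrite (_ : _ \o _ = fun w => (loc it w, response sim (loc it w) (seed (T w) (lab it)))).
  apply: measurable_fun_pair => //; apply: measurable_funD.
    apply: (measurable_comp unit_cube_measurable _ mean_meas ml).
    by move=> _ [w _ <-].
  apply: (measurable_comp _ _ noise_meas (measurable_fun_pair ml (seed_meas (nJ _ il)))).
    by apply: measurableX => //; exact: unit_cube_measurable.
  by move=> _ [w _ <-]; split=> //=; exact: cl.
by apply/funext => w /=; rewrite tnth_map.
Qed.

Lemma node_ok_chosen a n lI lJ : node_ok a n lI lJ ->
  dmeasurable (fun w => coin (T w) a) -> dmeasurable (fun w => dir (T w) a) ->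
  dmeasurable (fun w => (chosen sim mr (T w) (n w)).1) /\
  measurable_fun setT (fun w => (chosen sim mr (T w) (n w)).2).
Proof.
move=> ok mc md; have [an _ _ _ _] := ok.
pose v w := view_of (leaf_of sim (T w) (n w)).
have chE w : chosen sim mr (T w) (n w) =
    if coin (T w) a then (dir (T w) a, best_in_dir mr (v w) (dir (T w) a))
    else best_overall mr (v w).
  by rewrite /chosen (an w).1.
have m1 : dmeasurable (fun w => (best_overall mr (v w)).1).
  apply: dmeasurable_countable => j.
  rewrite (_ : _ @^-1` _ = (fun w => (best_overall mr (v w)).1 == j) @^-1` [set true]).
    apply: dmeasurable_bool.
    apply: (node_ok_view (g := fun v => (best_overall mr v).1 == j) ok) => k l.
    apply: (measurable_fun_bool true); rewrite setTI.
    have [_ /(_ j) + _] := mr_meas a k l.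
    by congr measurable; apply/seteqP; split=> p /= /eqP.
  by apply/seteqP; split=> w /= /eqP.
have mo : measurable_fun setT (fun w => (best_overall mr (v w)).2).
  apply: (node_ok_view (g := fun v => (best_overall mr v).2) ok) => k l.
  by have [_ _] := mr_meas a k l.
have md' j : measurable_fun setT (fun w => best_in_dir mr (v w) j).
  apply: (node_ok_view (g := fun v => best_in_dir mr v j) ok) => k l.
  by have [+ _ _] := mr_meas a k l; apply.
split.
  apply: (dmeasurable_eq _ (dmeasurable2
    (fun b (p : 'I_d * 'I_d) => if b then p.1 else p.2) mc
    (dmeasurable2 pair md m1))).
  by move=> w; rewrite chE /=; case: ifP.
apply: (measurable_fun_eq _ (@dmeasurable_select _ _ _ _ _ _
  (fun c w => if c.1 then best_in_dir mr (v w) c.2 else (best_overall mr (v w)).2)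
  (dmeasurable2 pair mc md) _)).
  by move=> w; rewrite chE /=; case: ifP.
by move=> [[] j] /=; [exact: md'|exact: mo].
Qed.

Lemma node_ok_cut a n lI lJ : node_ok a n lI lJ ->
  dmeasurable (fun w => coin (T w) a) -> dmeasurable (fun w => dir (T w) a) ->
  dmeasurable (fun w => (cut sim mr (T w) (n w)).1) /\
  measurable_fun setT (fun w => (cut sim mr (T w) (n w)).2).
Proof.
move=> ok mc md; have [m1 m2] := node_ok_chosen ok mc md; split=> //=.
have [_ [mlo mhi] _ _ _] := ok.
have mt (x : O -> vec R d) : measurable_fun setT x ->
    measurable_fun setT (fun w => tnth (x w) (chosen sim mr (T w) (n w)).1).
  move=> mx; apply: (@dmeasurable_select _ _ _ _ _ _ (fun j w => tnth (x w) j)) => // j.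
  exact: measurableT_comp (measurable_tnth _) mx.
by apply: measurable_maxr; [exact: mt|apply: measurable_minr => //; exact: mt].
Qed.

Lemma set_coord_measurable (x : O -> vec R d) (J : O -> 'I_d) (Z : O -> R) :
  measurable_fun setT x -> dmeasurable J -> measurable_fun setT Z ->
  measurable_fun setT (fun w => set_coord (x w) (J w) (Z w)).
Proof.
move=> mx mJ mZ; apply/measurable_fun_tnthP => i.
apply: (measurable_fun_eq _ (@dmeasurable_select _ _ _ _ _ _
  (fun j w => if i == j then Z w else tnth (x w) i) mJ _)).
  by move=> w /=; rewrite tnth_mktuple.
move=> j; case: (i == j) => //.
exact: measurableT_comp (measurable_tnth _) mx.
Qed.

Lemma node_ok_fill a n lI lJ : node_ok a n lI lJ -> labels_ok a lI ->
  exists lI' lJ', node_ok a (fun w => fill th (T w) (n w)) lI' lJ' /\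
    forall b, labels_ok (rcons a b) lI'.
Proof.
move=> ok lok; have [an [mlo mhi] rI rJ oJ] := ok.
set k := fbal th (size a).
pose newI := [seq Item (DrawI a i) (fun w => size (nI (n w)) <= i)%N
  (fun w => (fresh (T w) (n w) (DrawI a i)).2) | i <- iota 0 k].
pose newJ := [seq Item (DrawJ a i)
  (fun w => (size (nI (n w)) < k) && (i < k - size (nJ (n w))))%N
  (fun w => (fresh (T w) (n w) (DrawJ a i)).2) | i <- iota 0 k].
exists (lI ++ newI), (lJ ++ newJ); split; last by move=> b; exact: labels_ok_cat.
split=> //.
- by move=> w; have [? ?] := an w; split=> //; exact: boxed_fill.
- have := represents_fillI k ok; rewrite -/newI.
  by congr represents; apply/funext => w; rewrite /fill /= (an w).1.
- apply: represents_cat => //; split.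
    move=> _ /mapP[i _ ->]; apply: (fresh_item_ok _ ok).
    apply: (@dmeasurable2 _ _ _ _ _ andb).
      exact: (dmeasurable_comp (fun m => m < k)%N (represents_size rI)).
    exact: (dmeasurable_comp (fun m => i < k - m)%N (represents_size rJ)).
  move=> w; rewrite /items_at /newJ filter_map -map_comp /= (an w).1 -/k.
  rewrite (@eq_filter _ _
    (fun i => (size (nI (n w)) < k) && (i < k - size (nJ (n w))))%N)//.
  case: (size (nI (n w)) < k)%N; last by rewrite filter_pred0.
  by rewrite filter_iota_ltn (minn_idPl _) ?leq_subr.
- by move=> i; rewrite mem_cat => /orP[/oJ//|/mapP[j _ ->]].
Qed.

Lemma node_ok_vchild a b n lI lJ : node_ok a n lI lJ -> labels_ok a lI ->
  dmeasurable (fun w => coin (T w) a) -> dmeasurable (fun w => dir (T w) a) ->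
  exists lI' lJ', node_ok (rcons a b) (fun w => vchild sim th mr (T w) (n w) b) lI' lJ' /\
    labels_ok (rcons a b) lI'.
Proof.
move=> ok lok mc md; have [an _ _ _ _] := ok.
have [fI [fJ [okf /(_ b) [uf lf]]]] := node_ok_fill ok lok.
have [anf [mlo mhi] rI rJ oJ] := okf.
have [mj mz] := node_ok_cut okf mc md.
pose J w := (cut sim mr (T w) (fill th (T w) (n w))).1.
pose Z w := (cut sim mr (T w) (fill th (T w) (n w))).2.
have rs l F := represents_side b mj mz (l := l) (F := F).
exists [seq Item (lab i) (fun w => sel i w && side b (J w) (Z w) (loc i w)) (loc i)
             | i <- fI],
  [seq Item (lab i) (fun w => sel i w && side b (J w) (Z w) (loc i w)) (loc i)
             | i <- fJ]; split; last first.
  split; first by rewrite -map_comp.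
  by move=> _ /mapP[i ifI ->]; exact: (lf i ifI).
split=> //.
- move=> w; have [aw bw] := an w; split; last exact: boxed_vchild.
  by rewrite /= aw.
- split; rewrite /vchild /halve; case: b {lf rs} => //=.
    exact: set_coord_measurable.
  exact: set_coord_measurable.
- exact: rs.
- exact: rs.
- by move=> _ /mapP[i ifJ ->]; exact: (oJ i ifJ).
Qed.

(** Coins and directions are asked for at strict prefixes of [a] only: a node is settled before its
    own coin is tossed. *)
Lemma node_ok_at (a : seq bool) :
  (forall i, (i < size a)%N -> dmeasurable (fun w => coin (T w) (take i a)) /\
     dmeasurable (fun w => dir (T w) (take i a))) ->
  exists lI lJ, node_ok a (fun w => node_at sim th mr N0 inI (T w) a) lI lJ /\
    labels_ok a lI.
Proof.
elim/last_ind: a => [_|a b IH mcd].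
  pose it k := Item (Init k) (fun=> true) (fun w =>
    in_box [tuple (0 : R) | _ < d] [tuple (1 : R) | _ < d] (unif (T w) (Init k))).
  exists [seq it k | k <- iota 0 N0 & inI k], [seq it k | k <- iota 0 N0 & ~~ inI k].
  have itok k : item_ok (it k).
    split; first exact: dmeasurable_cst.
      apply: in_box_measurable => //; exact: measurable_cst.
    move=> w j; rewrite !tnth_mktuple subr0 add0r mulr1; exact: unif01.
  split; first split=> //.
  - by move=> w; split=> //; exact: (boxed_node_at sim th mr N0 inI (unif01 w) [::]).
  - by split=> [_ /mapP[k _ ->]//|w]; rewrite /items_at filter_map -map_comp filter_predT.
  - by split=> [_ /mapP[k _ ->]//|w]; rewrite /items_at filter_map -map_comp filter_predT.
  - by move=> _ /mapP[k + ->]; rewrite mem_filter => /andP[].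
  - split; last by move=> _ /mapP[k + ->]; rewrite mem_filter => /andP[/= ->].
    rewrite -map_comp map_inj_uniq ?filter_uniq ?iota_uniq//.
    by move=> i j [].
have mcd' i : (i < size a)%N -> dmeasurable (fun w => coin (T w) (take i a)) /\
     dmeasurable (fun w => dir (T w) (take i a)).
  move=> ia; have := mcd i; rewrite size_rcons -cats1 takel_cat ?(ltnW ia)//.
  by apply; exact: ltnW.
have [lI [lJ [ok lok]]] := IH mcd'.
have [mc md] : dmeasurable (fun w => coin (T w) a) /\ dmeasurable (fun w => dir (T w) a).
  by have := mcd (size a); rewrite size_rcons -cats1 take_size_cat//; apply.
have [lI' [lJ' H]] := node_ok_vchild b ok lok mc md; exists lI', lJ'.
by move: H; congr (node_ok _ _ _ _ /\ _); apply/funext => w; rewrite node_at_rcons.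
Qed.

(** Whether the path passes through [a] is likewise settled at the strict prefixes of [a]; this
    makes the event independent of the coin and the direction at [a]. *)
Lemma path_to_measurable (xstar : vec R d) (a : seq bool) :
  (forall i, (i < size a)%N -> dmeasurable (fun w => coin (T w) (take i a)) /\
     dmeasurable (fun w => dir (T w) (take i a))) ->
  measurable [set w | path_to sim th mr N0 inI (T w) xstar (size a) = a].
Proof.
elim/last_ind: a => [_|a b IH mcd].
  by rewrite (_ : [set w | _] = setT)//; apply/seteqP; split.
have mcd' i : (i < size a)%N -> dmeasurable (fun w => coin (T w) (take i a)) /\
     dmeasurable (fun w => dir (T w) (take i a)).
  move=> ia; have := mcd i; rewrite size_rcons -cats1 takel_cat ?(ltnW ia)//.
  by apply; exact: ltnW.
have [mc md] : dmeasurable (fun w => coin (T w) a) /\ dmeasurable (fun w => dir (T w) a).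
  by have := mcd (size a); rewrite size_rcons -cats1 take_size_cat//; apply.
have [lI [lJ [ok lok]]] := node_ok_at mcd'.
have [fI [fJ [okf _]]] := node_ok_fill ok lok.
have [mj mz] := node_ok_cut okf mc md.
have mt := @dmeasurable_side true _ _ (fun=> xstar) mj mz (@measurable_cst _ _ _ _ _ _).
rewrite (_ : [set w | _] =
  [set w | path_to sim th mr N0 inI (T w) xstar (size a) = a] `&`
  (fun w => turn sim th mr (T w) xstar (node_at sim th mr N0 inI (T w) a)) @^-1` [set b]).
  by apply: measurableI; [exact: IH|exact: mt].
apply/seteqP; split=> w /=; rewrite size_rcons /=.
  by move=> /rcons_inj[pa <-]; rewrite pa.
by move=> [-> ->].
Qed.

End NodeMeasurability.

(** * Sigma-algebras generated by table entries *)

HB.instance Definition _ (d : nat) := gen_eqMixin (entry d).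

Section TableSigmaAlgebras.
Context {dO : measure_display} {O : measurableType dO} {R : realType}.
Variable P : probability O R.
Context {d : nat} {dXi dW : measure_display} {Xi : measurableType dXi}
  {W : measurableType dW}.
Variables (Q : probability Xi R) (kap : R) (T : O -> table R d Xi W).
Hypothesis T_law : random_table P Q kap T.

Local Notation S := (sigma_of_entry T).

(** The set [O] with the smaller sigma-algebra of the entries in [E]. Measurability on this space
    expresses on which entries a quantity depends, and the lemmas on nodes apply to it as they
    stand. *)
Definition entries_space (E : set (entry d)) :=
  g_sigma_algebraType (\bigcup_(e in E) S e).

Lemma sigma_of_entry_setT e : S e setT.
Proof. by case: e => /= *; exists setT; rewrite //= setTI preimage_setT. Qed.

Lemma sigma_of_entry_setI e : setI_closed (S e).
Proof.
by case: e => /= [k j|k|a|a|] _ _ [A mA <-] [B mB <-];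
  exists (A `&` B); rewrite ?setTI//; exact: measurableI.
Qed.

Lemma sigma_entries_measurable E : sigma_of S E `<=` measurable.
Proof. by apply: sigma_of_measurable; case: T_law. Qed.

Lemma entries_independent E e A B : ~ E e -> sigma_of S E A -> S e B ->
  P (A `&` B) = (P A * P B)%E.
Proof.
apply: independent_sigma_of.
- by case: T_law.
- exact: sigma_of_entry_setT.
- exact: sigma_of_entry_setI.
- by case: T_law.
Qed.

Lemma id_entries_measurable E :
  measurable_fun setT (id : O -> entries_space E).
Proof. by move=> _ A mA; rewrite setTI; exact: (sigma_entries_measurable mA). Qed.

Lemma entry_in_space (E : set (entry d)) e A : E e -> S e A ->
  measurable (A : set (entries_space E)).
Proof. by move=> Ee SA; apply: sub_sigma_algebra; exists e. Qed.

Lemma unif_entries_measurable (E : set (entry d)) k j : E (UnifE k j) ->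
  measurable_fun setT (fun w : entries_space E => tnth (unif (T w) k) j).
Proof.
by move=> Ee _ B mB; apply: (entry_in_space Ee); exists B.
Qed.

Lemma seed_entries_measurable (E : set (entry d)) k : E (SeedE d k) ->
  measurable_fun setT (fun w : entries_space E => seed (T w) k).
Proof.
by move=> Ee _ B mB; apply: (entry_in_space Ee); exists B.
Qed.

Lemma coin_entries_measurable (E : set (entry d)) a : E (CoinE d a) ->
  dmeasurable (fun w : entries_space E => coin (T w) a).
Proof.
move=> Ee B; apply: (entry_in_space Ee); exists B => //.
by rewrite setTI.
Qed.

Lemma dir_entries_measurable (E : set (entry d)) a : E (DirE d a) ->
  dmeasurable (fun w : entries_space E => dir (T w) a).
Proof.
move=> Ee B; apply: (entry_in_space Ee); exists B => //.
by rewrite setTI.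
Qed.

Lemma entries_space_sub (E F : set (entry d)) {d' : measure_display}
    {X : measurableType d'} (f : O -> X) : E `<=` F ->
  measurable_fun setT (f : entries_space E -> X) ->
  measurable_fun setT (f : entries_space F -> X).
Proof.
move=> EF mf _ B mB; have := mf measurableT B mB.
exact: (sigma_of_sub EF).
Qed.

End TableSigmaAlgebras.

(** * Concentration of the noise *)

Section Concentration.
Context {dO : measure_display} {O : measurableType dO} {R : realType}.
Variable P : probability O R.
Context {d : nat} {dXi dW : measure_display} {Xi : measurableType dXi}
  {W : measurableType dW}.
Variables (Q : probability Xi R) (kap : R) (T : O -> table R d Xi W).
Hypothesis T_law : random_table P Q kap T.
Variable sim : simulator R d Xi.
Hypothesis noise_meas : measurable_fun (@unit_cube R d `*` setT)
  (fun p : vec R d * Xi => noise sim p.1 p.2).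
Variable c : R.
Hypothesis sub_gaussian : forall (x : vec R d) (lambda : R), unit_cube x ->
  ('E_Q[(fun xi => expR (lambda * noise sim x xi))]
     <= (expR (lambda ^+ 2 * c / 2))%:E)%E.
Variable inI : pred nat.

Definition non_I_seed : set (entry d) :=
  [set e | if e is SeedE k then ~~ is_I_draw inI k else true].

Local Notation space E := (entries_space T E).
Local Notation item := (item O R d).

Variable lam : R.

(** Normalized so that sub-Gaussianity makes its expectation at most [1] at every point of the
    cube. *)
Definition tilt (x : vec R d) (xi : Xi) : R :=
  expR (lam * noise sim x xi - lam ^+ 2 * c / 2).

Definition item_weight (i : item) (w : O) (xi : Xi) : R :=
  if sel i w then tilt (loc i w) xi else 1.

Definition items_weight (l : seq item) (w : O) : R :=
  \prod_(i <- l) item_weight i w (seed (T w) (lab i)).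

Lemma item_weight_ge0 i w xi : 0 <= item_weight i w xi.
Proof. by rewrite /item_weight; case: ifP; rewrite ?expR_ge0. Qed.

Lemma items_weight_ge0 l w : 0 <= items_weight l w.
Proof. by apply: prodr_ge0 => i _; exact: item_weight_ge0. Qed.

Definition seed_items (l : seq item) : set (entry d) :=
  non_I_seed `|` [set e | exists2 i, i \in l & e = SeedE d (lab i)].

Lemma item_weight_measurable (E : set (entry d)) (i : item) :
  @item_ok R d _ (space E) i ->
  measurable_fun setT (fun p : space E * Xi => item_weight i p.1 p.2).
Proof.
move=> [ms ml cl].
have m1 : measurable_fun setT (fun p : space E * Xi => sel i p.1).
  apply: (measurableT_comp (f := sel i : space E -> bool)) => //.
  by move=> _ B mB; rewrite setTI; exact: ms.
have m2 : measurable_fun setT (fun p : space E * Xi => noise sim (loc i p.1) p.2).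
  apply: (measurable_comp (F := @unit_cube R d `*` setT) _ _ noise_meas
    (g := fun p : space E * Xi => (loc i p.1, p.2))).
  - by apply: measurableX => //; exact: unit_cube_measurable.
  - by move=> _ [w _ <-]; split=> //=; exact: cl.
  - by apply: measurable_fun_pair => //; exact: measurableT_comp ml _.
rewrite /item_weight; apply: measurable_fun_ifT => //.
apply: measurableT_comp => //; apply: measurable_funB => //.
exact: measurable_funM.
Qed.

Lemma item_ok_sub (E F : set (entry d)) (i : item) : E `<=` F ->
  @item_ok R d _ (space E) i -> @item_ok R d _ (space F) i.
Proof.
move=> EF [ms ml cl]; split=> //; last exact: entries_space_sub ml.
by move=> A; exact: (sigma_of_sub EF (ms A)).
Qed.

Lemma items_weight_measurable (l : seq item) :
  (@items_ok R d _ (space non_I_seed) l) ->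
  measurable_fun setT (items_weight l : space (seed_items l) -> R).
Proof.
move=> ok; rewrite /items_weight.
(* The induction shortens the product while the sigma-algebra of [seed_items l] stays fixed. *)
suff H (l' : seq item) : {subset l' <= l} -> measurable_fun setT
    (fun w : space (seed_items l) =>
      \prod_(i <- l') item_weight i w (seed (T w) (lab i))).
  exact: H.
elim: l' => [|i l' IH] sub.
  rewrite (_ : (fun w => _) = fun=> 1); first exact: measurable_cst.
  by apply/funext => w; rewrite big_nil.
rewrite (_ : (fun w => _) = (fun w : space (seed_items l) =>
  item_weight i w (seed (T w) (lab i)) *
  \prod_(i <- l') item_weight i w (seed (T w) (lab i)))); last first.
  by apply/funext => w; rewrite big_cons.
apply: measurable_funM; last by apply: IH => j jl; apply: sub; rewrite inE jl orbT.
have il : i \in l by apply: sub; exact: mem_head.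
have oki : @item_ok R d _ (space (seed_items l)) i.
  by apply: item_ok_sub (ok i il) => e ?; left.
apply: (measurableT_comp (item_weight_measurable oki)
  (g := fun w : space (seed_items l) => (w, seed (T w) (lab i)))).
apply: measurable_fun_pair => //; apply: seed_entries_measurable.
by right; exists i.
Qed.

Lemma tilt_expectation (x : vec R d) : unit_cube x ->
  (\int[Q]_xi (tilt x xi)%:E <= 1)%E.
Proof.
move=> x01.
have mn : measurable_fun setT (noise sim x).
  apply: (measurable_comp (F := @unit_cube R d `*` setT) _ _ noise_meas
    (g := fun y : Xi => (x, y))).
  - by apply: measurableX => //; exact: unit_cube_measurable.
  - by move=> _ [w _ <-].
  - exact: measurable_fun_pair.
have e0 := expR_ge0 (- (lam ^+ 2 * c / 2)).
have -> : (fun xi => (tilt x xi)%:E) = (fun xi => (expR (- (lam ^+ 2 * c / 2)))%:E *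
    (expR (lam * noise sim x xi))%:E)%E.
  by apply/funext => xi; rewrite -EFinM mulrC -expRD.
rewrite ge0_integralZl_EFin//.
- have := sub_gaussian lam x01; rewrite unlock /= => H.
  apply: le_trans (lee_pmul _ _ (lexx _) H) _; rewrite ?lee_fin//.
    by apply: integral_ge0 => y _; rewrite lee_fin expR_ge0.
  by rewrite -expRD addNr expR0.
- apply/measurable_EFinP; apply: measurableT_comp => //; exact: measurable_funM.
Qed.

(** By honesty the indicators and locations do not involve the I-seeds, and the head label differs
    from the others. So the head seed is independent of everything else in the product, and freezing
    the rest leaves a factor of expectation at most [1]. *)
Lemma items_weight_expectation (l : seq item) :
  (@items_ok R d _ (space non_I_seed) l) -> uniq (map lab l) ->
  {in l, forall i, is_I_draw inI (lab i)} ->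
  (\int[P]_w (items_weight l w)%:E <= 1)%E.
Proof.
elim: l => [|i l IH] ok /=.
  move=> _ _; rewrite /items_weight; under eq_integral do rewrite big_nil.
  by rewrite integral_cst// mul1e probability_le1.
move=> /andP[il ul] isI.
have okl : @items_ok R d _ (space non_I_seed) l.
  by move=> j jl; apply: ok; rewrite inE jl orbT.
set E := seed_items l.
have oki : @item_ok R d _ (space E) i.
  by apply: item_ok_sub (ok i (mem_head _ _)) => e ?; left.
pose h (p : space E * Xi) : \bar R :=
  (items_weight l p.1 * item_weight i p.1 p.2)%:E.
have mgl := items_weight_measurable okl.
have mh : measurable_fun setT h.
  apply/measurable_EFinP; apply: measurable_funM.
    exact: measurableT_comp mgl _.
  exact: item_weight_measurable.
have h0 z : (0 <= h z)%E by rewrite lee_fin mulr_ge0 ?items_weight_ge0 ?item_weight_ge0.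
have mseed : measurable_fun setT (fun w => seed (T w) (lab i)).
  move=> _ B mB; have [+ _ _ _ _ _ _] := T_law; move=> /(_ (SeedE d (lab i))).
  by apply; exists B.
have nE : ~ E (SeedE d (lab i)).
  move=> [|[j jl [lE]]]; first by rewrite /= isI ?mem_head.
  by move/mapP: il; apply; exists j.
have -> : (\int[P]_w (items_weight (i :: l) w)%:E =
    \int[P]_w h (w, seed (T w) (lab i)))%E.
  by apply: eq_integral => w _; rewrite /h /items_weight big_cons mulrC.
rewrite (integral_independent_pair (Q := Q) (h := h) (id_entries_measurable T_law (E := E)) mseed)//; last first.
  move=> A B mA mB; rewrite (entries_independent T_law nE mA); last by exists B; rewrite ?setTI.
  by congr (_ * _)%E; have [_ _ _ _ sl _ _] := T_law; rewrite -(sl (lab i) B mB).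
apply: le_trans (IH okl ul _); last by move=> j jl; apply: isI; rewrite inE jl orbT.
have mglO : measurable_fun setT (items_weight l : O -> R).
  exact: measurableT_comp mgl (id_entries_measurable T_law (E := E)).
apply: ge0_le_integral => //.
- by move=> w _; apply: integral_ge0 => y _; exact: h0.
- exact: (measurableT_comp (measurable_fun_fubini_tonelli_F (m2 := Q) h mh h0)
    (id_entries_measurable T_law (E := E))).
- exact/measurable_EFinP.
move=> w _; rewrite /h /=.
under eq_integral do rewrite EFinM.
have mi : measurable_fun setT (fun y => (item_weight i w y)%:E).
  apply/measurable_EFinP; apply: (measurableT_comp (item_weight_measurable oki)
    (g := fun y : Xi => (w : space E, y))).
  exact: measurable_fun_pair.
have i0 y : (0 <= (item_weight i w y)%:E)%E by rewrite lee_fin item_weight_ge0.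
rewrite (ge0_integralZl_EFin Q measurableT _ mi) ?items_weight_ge0//.
rewrite -[leRHS]mule1; apply: lee_pmul => //.
- by rewrite lee_fin items_weight_ge0.
- exact: integral_ge0.
- rewrite /item_weight; case: (sel i w).
    by apply: tilt_expectation; have [] := oki.
  by rewrite integral_cst// mul1e probability_le1.
Qed.

End Concentration.

(** * Chernoff bound for the noise of a node *)

Section Deviation.
Context {dO : measure_display} {O : measurableType dO} {R : realType}.
Variable P : probability O R.
Context {d : nat} {dXi dW : measure_display} {Xi : measurableType dXi}
  {W : measurableType dW}.
Variables (Q : probability Xi R) (kap : R) (T : O -> table R d Xi W).
Hypothesis T_law : random_table P Q kap T.
Variable sim : simulator R d Xi.
Hypothesis noise_meas : measurable_fun (@unit_cube R d `*` setT)
  (fun p : vec R d * Xi => noise sim p.1 p.2).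
Variable c : R.
Hypothesis c_gt0 : 0 < c.
Hypothesis sub_gaussian : forall (x : vec R d) (lambda : R), unit_cube x ->
  ('E_Q[(fun xi => expR (lambda * noise sim x xi))]
     <= (expR (lambda ^+ 2 * c / 2))%:E)%E.
Variable inI : pred nat.

Local Notation space := (entries_space T (non_I_seed inI)).

Definition noise_total (F : O -> seq (draw * vec R d)) (w : O) : R :=
  \sum_(p <- F w) noise sim p.2 (seed (T w) p.1).

Lemma items_weightE lam l F w : @represents R d _ space l F ->
  items_weight T sim c lam l w =
  expR (lam * noise_total F w - (size (F w))%:R * (lam ^+ 2 * c / 2)).
Proof.
move=> [_ e]; rewrite /noise_total e /items_at /items_weight size_map big_map.
rewrite mulr_sumr.
elim: l {e} => [|i l IH]; first by rewrite !big_nil mul0r subr0 expR0.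
rewrite big_cons IH /= /item_weight; case: (sel i w) => /=; last by rewrite mul1r.
rewrite big_cons /tilt -expRD; congr expR; rewrite -natr1; ring.
Qed.

(** Markov's inequality for the weight, whose expectation is at most [1]. *)
Lemma weight_deviation lam l F t : @represents R d _ space l F ->
  uniq (map lab l) -> {in l, forall i, is_I_draw inI (lab i)} ->
  let B := [set w | expR t <= items_weight T sim c lam l w] in
  measurable B /\ (P B <= (expR (- t))%:E)%E.
Proof.
move=> [ok e] ul isI B.
have mZ : measurable_fun setT (items_weight T sim c lam l).
  have m := items_weight_measurable noise_meas c lam ok.
  exact: (measurableT_comp m (id_entries_measurable T_law (E := seed_items inI l))).
have mB : measurable B.
  by rewrite -[B]setTI; apply: measurable_fun_le => //; exact: measurable_cst.
split=> //.
have mZE : measurable_fun setT (fun w => (items_weight T sim c lam l w)%:E).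
  exact/measurable_EFinP.
have Z0 w : (0 <= (items_weight T sim c lam l w)%:E)%E.
  by rewrite lee_fin items_weight_ge0.
have : ((expR t)%:E * P B <= 1)%E.
  apply: le_trans (items_weight_expectation T_law noise_meas sub_gaussian lam ok ul isI).
  rewrite -integral_cst//.
  apply: le_trans (_ : (\int[P]_(w in B) (items_weight T sim c lam l w)%:E <= _)%E).
    apply: ge0_le_integral => //.
    - by move=> w _; rewrite lee_fin expR_ge0.
    - exact: measurable_funTS.
  exact: ge0_subset_integral.
have fB : P B \is a fin_num by exact: fin_num_measure.
rewrite -(fineK fB) -EFinM !lee_fin expRN => le1.
by rewrite -[leRHS]mul1r ler_pdivlMr ?expR_gt0// mulrC.
Qed.

(** The exceptional set is defined by the weights, without reference to the noise itself or to the
    number of samples; [size (F w) = k] serves only to read the noise off the weights. *)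
Lemma noise_deviation l F (k : nat) (e : R) : 0 < e -> @represents R d _ space l F ->
  uniq (map lab l) -> {in l, forall i, is_I_draw inI (lab i)} ->
  exists B, [/\ measurable B,
    (P B <= (2 * expR (- (k%:R * (e ^+ 2 / (2 * c)))))%:E)%E &
    forall w, ~ B w -> size (F w) = k -> `|noise_total F w| <= e * k%:R].
Proof.
move=> e0 rF ul isI; set t := k%:R * (e ^+ 2 / (2 * c)).
(* [e / c] is the optimal Chernoff parameter: [lam e - lam^2 c / 2] then equals [e^2 / (2c)]. Its
   opposite handles the lower tail. *)
have [m1 P1] := weight_deviation (e / c) t rF ul isI.
have [m2 P2] := weight_deviation (- (e / c)) t rF ul isI.
set B1 := [set w | _] in m1 P1; set B2 := [set w | _] in m2 P2.
exists (B1 `|` B2); split; first exact: measurableU.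
  apply: le_trans (measureU2 _ m1 m2) _.
  by rewrite mulr_natl mulr2n EFinD; exact: leeD.
move=> w /not_orP[/negP + /negP +] sF.
rewrite -!ltNge !(items_weightE _ _ rF) sF !ltr_expR /t => h1 h2.
move: h1 h2; set N := noise_total F w; set u := e / c.
have eE : e = u * c by rewrite /u divfK// gt_eqF.
have u0 : 0 < u by rewrite /u divr_gt0.
have -> : k%:R * (e ^+ 2 / (2 * c)) = k%:R * u ^+ 2 * c / 2.
  by rewrite eE; field; rewrite gt_eqF.
rewrite sqrrN eE => h1 h2; rewrite ler_norml; apply/andP; split.
  by rewrite -(ler_pM2l u0); lra.
by rewrite -(ler_pM2l u0); lra.
Qed.

End Deviation.

(** * Splits along the path to the maximizer *)

Section TotalProbability.
Context {dO : measure_display} {O : measurableType dO} {R : realType}.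
Variable P : probability O R.

Lemma total_probability (C : finType) (M : O -> C) (A : set O) :
  measurable A -> (forall c, measurable (M @^-1` [set c])) ->
  fine (P A) = \sum_c fine (P (A `&` M @^-1` [set c])).
Proof.
move=> mA mM.
have mAM c : measurable (A `&` M @^-1` [set c]) by exact: measurableI.
have AE : A = \bigcup_(c in [set` enum C]) (A `&` M @^-1` [set c]).
  apply/seteqP; split=> [w Aw|w [c _ []]//].
  by exists (M w); rewrite //= mem_enum.
rewrite {1}AE measure_fin_bigcup//; last first.
  apply/trivIsetP => c c' _ _ /eqP cc'; rewrite -subset0 => w [[_ Mc] [_ Mc']].
  by apply: cc'; move: Mc Mc' => /= <- <-.
rewrite -fsbig_seq ?enum_uniq// big_enum /=.
rewrite (eq_bigr (fun c => (fine (P (A `&` M @^-1` [set c])))%:E)); last first.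
  by move=> c _; rewrite fineK// fin_num_measure.
by rewrite sumEFin.
Qed.

End TotalProbability.

Section PathHits.
Context {R : realType} {d : nat} {dXi dW : measure_display}
  {Xi : measurableType dXi} {W : measurableType dW}.
Variables (sim : simulator R d Xi) (th : tuning R) (mr : minimizer_rule R d).
Hypothesis mean_meas : measurable_fun (@unit_cube R d) (mean_fun sim).
Hypothesis noise_meas : measurable_fun (@unit_cube R d `*` setT)
  (fun p : vec R d * Xi => noise sim p.1 p.2).
Hypothesis mr_meas : minimizer_rule_measurable mr.
Variables (N0 : nat) (inI : pred nat) (xstar : vec R d).
Context {dO : measure_display} {O : measurableType dO}.
Variables (P : probability O R) (Q : probability Xi R) (kap : R).
Variable T : O -> table R d Xi W.
Hypothesis T_law : random_table P Q kap T.
Hypothesis kap01 : 0 < kap <= 1.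

Local Notation path_to := (path_to sim th mr N0 inI ^~ xstar).

Let unif01 w k j : 0 <= tnth (unif (T w) k) j <= 1.
Proof. by have [_ _ /(_ w k j)/andP[/ltW -> ->]] := T_law. Qed.

(** Everything except the coin and the direction at [a], later entries included: what matters is
    independence of these two, not chronology. *)
Definition past_of (a : seq bool) : set (entry d) :=
  [set e | match e with CoinE b | DirE b => b != a | _ => true end].

Local Notation past a := (entries_space T (past_of a)).

Definition hit (j : 'I_d) (a : seq bool) (w : O) : bool :=
  coin (T w) a && (dir (T w) a == j).

Lemma prefix_neq (a : seq bool) i : (i < size a)%N -> take i a != a.
Proof.
by move=> ia; apply/eqP => /(congr1 size); rewrite size_takel 1?ltnW// => iE; rewrite iE ltnn in ia.
Qed.

Lemma past_coin_dir a i : (i < size a)%N ->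
  dmeasurable (fun w : past a => coin (T w) (take i a)) /\
  dmeasurable (fun w : past a => dir (T w) (take i a)).
Proof.
move=> ia; split.
  by apply: coin_entries_measurable; exact: prefix_neq.
by apply: dir_entries_measurable; exact: prefix_neq.
Qed.

Lemma path_event_past a :
  sigma_of (sigma_of_entry T) (past_of a) [set w | path_to (T w) (size a) = a].
Proof.
apply: (path_to_measurable (T := T : past a -> _) th mean_meas noise_meas mr_meas N0 _ _ _ xstar).
- exact: unif01.
- by move=> k j; exact: unif_entries_measurable.
- by move=> k _; exact: seed_entries_measurable.
- exact: past_coin_dir.
Qed.

Arguments path_event_past : clear implicits.

Lemma hits_event_past j a m :
  sigma_of (sigma_of_entry T) (past_of a) [set w | hits (T w) j a < m]%N.
Proof.
rewrite /hits.
have mh (i : 'I_(size a)) : dmeasurable (fun w : past a =>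
    (coin (T w) (take i a) && (dir (T w) (take i a) == j) : nat)).
  have [mc md] := past_coin_dir (ltn_ord i).
  exact: (dmeasurable2 (fun b j' => b && (j' == j) : nat) mc md).
have : dmeasurable (fun w : past a => \sum_(i < size a)
    (coin (T w) (take i a) && (dir (T w) (take i a) == j))%N : nat).
  elim: (index_enum _) => [|i s IH].
    by apply: (dmeasurable_eq _ (dmeasurable_cst 0%N)) => w; rewrite big_nil.
  by apply: (dmeasurable_eq _ (dmeasurable2 addn (mh i) IH)) => w; rewrite big_cons.
by move=> /(_ [set k | k < m]%N).
Qed.

(** The direction is split off from the past enlarged by the coin, then the coin from the past. *)
Lemma hit_probability a j (A : set O) :
  sigma_of (sigma_of_entry T) (past_of a) A ->
  fine (P (A `&` [set w | hit j a w])) = kap / d%:R * fine (P A).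
Proof.
move=> GA; have mA := sigma_entries_measurable T_law GA.
set C := [set w | coin (T w) a]; set D := [set w | dir (T w) a = j].
have SC : sigma_of_entry T (CoinE d a) C by exists [set true]; rewrite // setTI.
have SD : sigma_of_entry T (DirE d a) D by exists [set j]; rewrite // setTI.
have [tm _ _ _ _ cl dl] := T_law.
have mC := tm _ _ SC; have mD := tm _ _ SD.
have -> : A `&` [set w | hit j a w] = (A `&` C) `&` D.
  apply/seteqP; split=> w; first by move=> [Aw /andP[Cw /eqP Dw]].
  by move=> [[Aw Cw] /eqP Dw]; split=> //; apply/andP.
have nC : ~ past_of a (CoinE d a) by rewrite /past_of /= eqxx.
have nD : ~ (past_of a `|` [set CoinE d a]) (DirE d a).
  by move=> [|//]; rewrite /past_of /= eqxx.
have GAC : sigma_of (sigma_of_entry T) (past_of a `|` [set CoinE d a]) (A `&` C).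
  apply: (@measurableI _ (entries_space T (past_of a `|` [set CoinE d a]))).
    by apply: sigma_of_sub GA => e; left.
  by apply: (entry_in_space (e := CoinE d a)) => //; right.
rewrite (entries_independent T_law nD GAC SD) (entries_independent T_law nC GA SC).
have -> : P C = kap%:E := cl a.
have -> : P D = (d%:R^-1)%:E := dl a j.
rewrite !fineM ?fin_numM ?fin_num_measure//=; lra.
Qed.

Lemma hit_measurable a j : measurable [set w | hit j a w].
Proof.
have [tm _ _ _ _ _ _] := T_law.
have -> : [set w | hit j a w] =
    [set w | coin (T w) a] `&` [set w | dir (T w) a = j].
  by apply/seteqP; split=> w /=; [move=> /andP[-> /eqP ->]|rewrite /hit; move=> [-> ->]; rewrite eqxx].
apply: measurableI.
  by apply: (tm (CoinE d a)); exists [set true]; rewrite // setTI.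
by apply: (tm (DirE d a)); exists [set j]; rewrite // setTI.
Qed.

Lemma miss_probability a j (A : set O) :
  sigma_of (sigma_of_entry T) (past_of a) A ->
  fine (P (A `\` [set w | hit j a w])) = (1 - kap / d%:R) * fine (P A).
Proof.
move=> GA; have mA := sigma_entries_measurable T_law GA.
have mH := hit_measurable a j.
rewrite mulrBl mul1r -(hit_probability j GA).
have := measureDI P mA mH => /(congr1 fine).
rewrite fineD ?fin_num_measure//; [|exact: measurableD|exact: measurableI].
by move=> ->; rewrite addrK.
Qed.

(** The path as a point of a finite type, so that events can be summed over its values. *)
Definition path_tuple (c : nat) (w : O) : c.-tuple bool :=
  Tuple (introT eqP (size_path_to sim th mr N0 inI (T w) xstar c)).

Definition few_hits (j : 'I_d) (c m : nat) : set O :=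
  [set w | hits (T w) j (path_to (T w) c) < m]%N.

Lemma path_tuple_preimage c (a : c.-tuple bool) :
  path_tuple c @^-1` [set a] = [set w | path_to (T w) (size a) = a].
Proof.
rewrite size_tuple; apply/seteqP; split=> w /=; first by move=> <-.
by move=> pa; apply/val_inj.
Qed.

Lemma few_hits_on_path j c m (a : c.-tuple bool) :
  few_hits j c m `&` path_tuple c @^-1` [set a] =
  [set w | path_to (T w) (size a) = a] `&` [set w | hits (T w) j a < m]%N.
Proof.
rewrite path_tuple_preimage /few_hits size_tuple.
by apply/seteqP; split=> w /= [h1 h2]; split=> //; [rewrite -h2|rewrite h1].
Qed.

Lemma few_hits_past j c m (a : c.-tuple bool) :
  sigma_of (sigma_of_entry T) (past_of a)
    (few_hits j c m `&` path_tuple c @^-1` [set a]).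
Proof.
rewrite few_hits_on_path; apply: (@measurableI _ (past a)).
  exact: path_event_past.
exact: hits_event_past.
Qed.

Arguments few_hits_past : clear implicits.

Lemma path_tuple_measurable c (a : c.-tuple bool) :
  measurable (path_tuple c @^-1` [set a]).
Proof.
rewrite path_tuple_preimage.
exact: (sigma_entries_measurable T_law (path_event_past a)).
Qed.

Lemma few_hits_measurable j c m : measurable (few_hits j c m).
Proof.
have -> : few_hits j c m = \bigcup_(a : c.-tuple bool)
    (few_hits j c m `&` path_tuple c @^-1` [set a]).
  by apply/seteqP; split=> [w|w [a _ []]//]; exists (path_tuple c w).
apply: countable_bigcupT_measurable; first exact: countableP.
move=> a; exact: (sigma_entries_measurable T_law (few_hits_past j c m a)).
Qed.

(** Sum over the node [a] reached at level [c]: a hit at [a] is independent of the count so far.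
    Fewer than [m + 1] hits afterwards means a miss with fewer than [m + 1] before, or a hit with
    fewer than [m]. *)
Lemma few_hits_step j c m : fine (P (few_hits j c.+1 m.+1)) <=
  (1 - kap / d%:R) * fine (P (few_hits j c m.+1)) +
  kap / d%:R * fine (P (few_hits j c m)).
Proof.
have tot m' c' := total_probability P (few_hits_measurable j c' m')
  (@path_tuple_measurable c).
rewrite !tot !mulr_sumr -big_split /=; apply: ler_sum => a _.
set G1 := few_hits j c m.+1 `&` _; set G0 := few_hits j c m `&` _.
have g1 := few_hits_past j c m.+1 a; have g0 := few_hits_past j c m a.
rewrite -(miss_probability j g1) -(hit_probability j g0) -/G1 -/G0.
have mG1 := sigma_entries_measurable T_law g1.
have mG0 := sigma_entries_measurable T_law g0.
have mH := hit_measurable a j.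
have m1 : measurable (G1 `\` [set w | hit j a w]) by exact: measurableD.
have m0 : measurable (G0 `&` [set w | hit j a w]) by exact: measurableI.
have mL : measurable (few_hits j c.+1 m.+1 `&` path_tuple c @^-1` [set a]).
  by apply: measurableI; [exact: few_hits_measurable|exact: path_tuple_measurable].
rewrite -lee_fin EFinD !fineK ?fin_num_measure//.
apply: le_trans (measureU2 _ m1 m0).
apply: le_measure; rewrite ?inE//; first exact: measurableU.
rewrite /G1 /G0 !few_hits_on_path path_tuple_preimage size_tuple.
move=> w [] /= + pa; rewrite /few_hits /= hits_rcons pa.
rewrite -/(hit j a w); case E : (hit j a w); rewrite ?addn1 ?addn0 => h.
  by right.
by left; split=> //; rewrite /= E.
Qed.

(** With [p = kap / d], the bound satisfies the recursion of [few_hits_step] with equality, as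
    [2 (1 - p) + p = 2 (1 - p / 2)]. It is the Markov bound for [2^-hits]. *)
Lemma few_hits_bound j c m :
  fine (P (few_hits j c m)) <= 2 ^+ m * (1 - kap / d%:R / 2) ^+ c.
Proof.
have d1 : (1 : R) <= d%:R by rewrite ler1n; case: (d) j => // -[].
have p01 : 0 < kap / d%:R <= 1.
  have d0 : (0 : R) < d%:R by lra.
  have /andP[k0 k1] := kap01.
  by rewrite divr_gt0//= ler_pdivrMr// mul1r; lra.
elim: c m => [|c IH] [|m].
- rewrite (_ : few_hits _ _ _ = set0) ?measure0 ?mulr1//.
  by rewrite -subset0 => w; rewrite /few_hits /= ltn0.
- rewrite expr0 mulr1; apply: le_trans (_ : 1 <= _); last by rewrite exprn_ege1//; lra.
  by rewrite -lee_fin fineK ?fin_num_measure ?probability_le1//; exact: few_hits_measurable.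
- rewrite (_ : few_hits _ _ _ = set0); last first.
    by rewrite -subset0 => w; rewrite /few_hits /= ltn0.
  by rewrite measure0 mulr_ge0 ?exprn_ge0//=; lra.
- apply: le_trans (few_hits_step j c m) _.
  move: (IH m.+1) (IH m); move: (fine _) (fine _) => y x; rewrite !exprS.
  have : 0 <= 2 ^+ m * (1 - kap / d%:R / 2) ^+ c by rewrite mulr_ge0 ?exprn_ge0//; lra.
  move: (2 ^+ m) ((1 - kap / d%:R / 2) ^+ c) p01 => u v; move: (kap / d%:R) => p.
  move=> /andP[p0 p1] uv h1 h2.
  have a1 : (1 - p) * x <= (1 - p) * (2 * u * v) by rewrite ler_wpM2l//; lra.
  have a2 : p * y <= p * (u * v) by rewrite ler_wpM2l//; lra.
  apply: le_trans (lerD a1 a2) _.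
  by rewrite le_eqVlt; apply/orP; left; apply/eqP; field.
Qed.

End PathHits.

(** * Growth of the sample balance and union bounds *)

(** For the counting argument: trees of depth [h / 2] whose leaves hold at most [K h] samples cannot
    absorb [2^h - 1] samples. With [m = h./2], [2^h >= 2^m * 2^m] and [2^m] beats any linear
    function of [h]. *)
Lemma exp2_dominates (K : nat) : exists h0, forall h, (h0 <= h)%N ->
  (3 * (2 ^ h./2 * (K * h)) + 2 < 2 ^ h)%N.
Proof.
(* Ensures [j + 1 >= 12 K + 4] below, so that [(j + 1)^2] exceeds [3 K h + 2], where
   [h <= 4 (j + 1)]. *)
exists (4 * (12 * K + 4))%N => h hK.
set m := h./2; set j := m./2.
have hm : (2 * m <= h <= 2 * m + 1)%N by have := odd_double_half h; rewrite -/m; lia.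
have mj : (2 * j <= m <= 2 * j + 1)%N by have := odd_double_half m; rewrite -/j; lia.
have j1 : (j < 2 ^ j)%N by exact: ltn_expl.
have m1 : ((j + 1) * (j + 1) <= 2 ^ m)%N.
  apply: leq_trans (_ : 2 ^ j * 2 ^ j <= _)%N; first by apply: leq_mul; lia.
  by rewrite -expnD leq_exp2l//; lia.
have h1 : (2 ^ m * 2 ^ m <= 2 ^ h)%N by rewrite -expnD leq_exp2l//; lia.
move: m1 h1; move: (2 ^ m)%N (2 ^ h)%N => M H m1 h1.
have jK : (12 * K + 4 <= j + 1)%N by lia.
have h4 : (h <= 4 * (j + 1))%N by lia.
have : (3 * (K * h) + 2 < M)%N.
  apply: leq_trans m1; nia.
nia.
Qed.

Lemma slow_depth_growth (f hmin hmax : nat -> nat) :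
  {homo f : c c' / (c <= c')%N} ->
  (\forall N \near \oo, [/\ (hmin N <= hmax N)%N,
     (0 < hmin N -> 2 ^ hmin N <= N)%N &
     (N <= 3 * (2 ^ hmax N * f (hmax N)) + 1)%N]) ->
  (forall K, \forall N \near \oo, (K * hmax N <= f (hmin N))%N) ->
  (forall K, \forall N \near \oo, (K <= hmin N)%N) ->
  forall K, \forall N \near \oo, (K * hmin N <= f (hmin N).-1)%N.
Proof.
move=> fmono [n1 _ count] ratio hinf K.
(* The factor [2] is what brings [hmax N'] down to [h / 2] below. *)
have [n2 _ rat] := ratio (2 * K)%N.
have [h0 dom] := exp2_dominates K.
near=> N.
(* The thresholds are put on [hmin N], because [N' = 2 ^ h - 1 >= h] has to be large too. *)
have hN : (maxn h0 (maxn 2 (maxn n1 n2)) <= hmin N)%N by near: N; exact: hinf.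
set h := hmin N in hN *.
rewrite leqNgt; apply/negP => small.
(* One short of the [2 ^ h] samples that non-empty leaves of depth at least [h] require: thus
   [hmin N' <= h - 1], and the ratio bound at [N'] says something about [f (h - 1)]. *)
pose N' := (2 ^ h - 1)%N.
have h2h : (h < 2 ^ h)%N by exact: ltn_expl.
have N'E : N'.+1 = (2 ^ h)%N by rewrite /N'; lia.
have [le1 lo up] : [/\ (hmin N' <= hmax N')%N,
     (0 < hmin N' -> 2 ^ hmin N' <= N')%N &
     (N' <= 3 * (2 ^ hmax N' * f (hmax N')) + 1)%N].
  by apply: count; rewrite /= /N'; lia.
have rN : (2 * K * hmax N' <= f (hmin N'))%N by apply: rat; rewrite /= /N'; lia.
have hm : (hmin N' <= h.-1)%N.
  have [->//|/lo h2] := posnP (hmin N').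
  have : (2 ^ hmin N' < 2 ^ h)%N by rewrite -N'E ltnS.
  by rewrite ltn_exp2l//; lia.
have f1 : (f (hmin N') <= f h.-1)%N := fmono _ _ hm.
have hM : (hmax N' <= h./2)%N.
  have : (2 * K * hmax N' < K * h)%N.
    by apply: leq_ltn_trans rN _; exact: leq_ltn_trans f1 _.
  have := odd_double_half h; nia.
have f2 : (f (hmax N') <= K * h)%N.
  by apply: leq_trans (ltnW small); apply: fmono; have := odd_double_half h; lia.
have := dom h; have := up; rewrite -N'E; clearbody N'.
have : (2 ^ hmax N' * f (hmax N') <= 2 ^ h./2 * (K * h))%N.
  by apply: leq_mul => //; rewrite leq_exp2l.
lia.
Unshelve. all: by end_near. Qed.

(** * Bounds on outer probabilities *)

Section OuterBounds.
Context {dO : measure_display} {O : measurableType dO} {R : realType}.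
Variable P : probability O R.

(** Stated through a measurable cover, so that unions of events can be bounded without proving the
    events themselves measurable. *)
Definition outer_le (E : set O) (b : R) : Prop :=
  exists B, [/\ measurable B, (P B <= b%:E)%E & E `<=` B].

Lemma outer_le_measurable E b : measurable E -> outer_le E b -> fine (P E) <= b.
Proof.
move=> mE [B [mB PB EB]]; rewrite -lee_fin fineK ?fin_num_measure//.
by apply: le_trans PB; apply: le_measure; rewrite ?inE.
Qed.

Lemma outer_le_sub E F b : E `<=` F -> outer_le F b -> outer_le E b.
Proof. by move=> EF [B [mB PB FB]]; exists B; split=> //; exact: subset_trans FB. Qed.

Lemma outer_le_ub E b b' : b <= b' -> outer_le E b -> outer_le E b'.
Proof.
by move=> bb [B [mB PB EB]]; exists B; split=> //; apply: le_trans PB _; rewrite lee_fin.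
Qed.

Lemma outer_leU E F b b' : outer_le E b -> outer_le F b' ->
  outer_le (E `|` F) (b + b').
Proof.
move=> [B [mB PB EB]] [C [mC PC FC]]; exists (B `|` C); split.
- exact: measurableU.
- by apply: le_trans (measureU2 _ mB mC) _; rewrite EFinD; exact: leeD.
- by apply: setUSS.
Qed.

Lemma outer_le_bigcup (I : eqType) (s : seq I) (E : I -> set O) (b : I -> R) :
  {in s, forall i, outer_le (E i) (b i)} ->
  outer_le (\bigcup_(i in [set` s]) E i) (\sum_(i <- s) b i).
Proof.
elim: s => [|i s IH] Es.
  by exists set0; rewrite big_nil measure0; split=> // w [].
rewrite big_cons (_ : \bigcup_(j in _) E j = E i `|` \bigcup_(j in [set` s]) E j).
  apply: outer_leU.
    by apply: Es; exact: mem_head.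
  by apply: IH => j js; apply: Es; rewrite inE js orbT.
apply/seteqP; split=> [w [j]|w [Ew|[j js Ew]]] /=.
- by rewrite inE => /orP[/eqP ->|js] Ew; [left|right; exists j].
- by exists i; rewrite //= mem_head.
- by exists j; rewrite //= inE js orbT.
Qed.

End OuterBounds.

(** * Geometric sums and tails *)

Lemma geometric_sum_le (R : realType) (s : R) (n : nat) : 0 <= s -> s < 1 ->
  \sum_(i < n) s ^+ i <= (1 - s)^-1.
Proof.
move=> s0 s1; have d0 : 0 < 1 - s by lra.
rewrite -[leRHS]mul1r ler_pdivlMr// mulrC -opprB mulNr -subrX1 opprB.
by rewrite lerBlDr lerDl exprn_ge0.
Qed.

(** Half of each exponent is bounded by its value at [t]; the other half is the term of a geometric
    series. *)
Lemma exp_tail_sum_le (R : realType) (rho t : R) (n : nat) : 0 < rho ->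
  \sum_(k < n | t <= k%:R) expR (- (k%:R * rho)) <=
  expR (- (t * (rho / 2))) / (1 - expR (- (rho / 2))).
Proof.
move=> r0.
apply: le_trans (_ : \sum_(k < n) expR (- (t * (rho / 2))) * expR (- (rho / 2)) ^+ k <= _).
  rewrite big_mkcond /=; apply: ler_sum => k _.
  case: ifPn => tk; last by rewrite mulr_ge0 ?exprn_ge0 ?expR_ge0.
  rewrite -expRM_natr -expRD ler_expR.
  have r2 : 0 <= rho / 2 by lra.
  by have := ler_wpM2r r2 tk; lra.
rewrite -mulr_sumr ler_wpM2l ?expR_ge0//; apply: geometric_sum_le.
  exact: expR_ge0.
by rewrite expR_lt1; lra.
Qed.

Lemma pow_eventually_le (R : realType) (z e : R) : 0 <= z < 1 -> 0 < e ->
  exists h0, forall h, (h0 <= h)%N -> z ^+ h <= e.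
Proof.
move=> /andP[z0 z1] e0.
have /cvgrPdist_le/(_ e e0)[h0 _ H] : z ^+ n @[n --> \oo] --> (0 : R).
  by apply: cvg_expr; rewrite ger0_norm.
exists h0 => h hh; have := H h hh.
by rewrite /= sub0r normrN ger0_norm ?exprn_ge0.
Qed.

Lemma half_pow_tail_le (R : realType) (h n : nat) :
  \sum_(c <- iota h n) (2^-1 : R) ^+ c <= 2 * 2^-1 ^+ h.
Proof.
elim: n h => [|n IH] h /=; first by rewrite big_nil mulr_ge0 ?exprn_ge0.
rewrite big_cons; apply: le_trans (lerD (lexx _) (IH h.+1)) _.
by rewrite exprS; lra.
Qed.

(** * Union bound for the noise over the virtual tree *)

Section Convergence.
Context {R : realType} {d : nat} {dXi dW : measure_display}
  {Xi : measurableType dXi} {W : measurableType dW}.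
Variables (Q : probability Xi R) (sim : simulator R d Xi).
Hypothesis mean_meas : measurable_fun (@unit_cube R d) (mean_fun sim).
Hypothesis noise_meas : measurable_fun (@unit_cube R d `*` setT)
  (fun p : vec R d * Xi => noise sim p.1 p.2).
Variable c : R.
Hypothesis c_gt0 : 0 < c.
Hypothesis sub_gaussian : forall (x : vec R d) (lambda : R), unit_cube x ->
  ('E_Q[(fun xi => expR (lambda * noise sim x xi))]
     <= (expR (lambda ^+ 2 * c / 2))%:E)%E.
Variables (th : tuning R) (mr : minimizer_rule R d).
Hypothesis mr_meas : minimizer_rule_measurable mr.
Variables (N0 : nat) (inI : pred nat).
Context {dO : measure_display} {O : measurableType dO}.
Variables (P : probability O R) (kap : R) (T : O -> table R d Xi W).
Hypothesis T_law : random_table P Q kap T.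

Let unif01 w k j : 0 <= tnth (unif (T w) k) j <= 1.
Proof. by have [_ _ /(_ w k j)/andP[/ltW -> ->]] := T_law. Qed.

Definition data_at (a : seq bool) (k : nat) (w : O) : seq (draw * vec R d) :=
  nI (fillI (T w) k (node_at sim th mr N0 inI (T w) a)).

Definition noisy (e : R) (a : seq bool) (k : nat) : set O :=
  [set w | size (data_at a k w) = k /\
     e * k%:R < `|noise_total T sim (data_at a k) w|].

Lemma noisy_outer_le (e : R) (a : seq bool) (k : nat) : 0 < e ->
  outer_le P (noisy e a k) (2 * expR (- (k%:R * (e ^+ 2 / (2 * c))))).
Proof.
move=> e0.
pose T' := T : entries_space T (non_I_seed inI) -> _.
have um k' j : measurable_fun setT (fun w => tnth (unif (T' w) k') j).
  exact: unif_entries_measurable.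
have [lI [lJ [ok lok]]] : exists lI lJ,
    node_ok inI a (fun w => node_at sim th mr N0 inI (T' w) a) lI lJ /\
    labels_ok inI a lI.
  apply: (node_ok_at th mean_meas noise_meas mr_meas N0 (inI := inI)) => //.
  - by move=> k' nk; exact: seed_entries_measurable.
  - by move=> i _; split; [exact: coin_entries_measurable|exact: dir_entries_measurable].
have rep := represents_fillI (T := T') unif01 um k ok.
(* The turn [true] is arbitrary: only the distinctness of the labels and their being I-draws are
   used. *)
have [ul isI] := labels_ok_cat true k
  (fun i w => size (nI (node_at sim th mr N0 inI (T' w) a)) <= i)%N
  (fun i w => (fresh (T' w) (node_at sim th mr N0 inI (T' w) a) (DrawI a i)).2) lok.
have [|B [mB PB BP]] := noise_deviation T_law noise_meas c_gt0 sub_gaussian k e0 rep ul.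
  by move=> i /isI/andP[].
exists B; split=> // w [sk dev]; apply: contrapT => nB.
by have := BP w nB sk; rewrite leNgt dev.
Qed.

(** Passage from a run to the virtual tree: whatever the strategy, the noise of a leaf is that of
    the virtual node with the same address and count. *)
Lemma noise_sum_noisy (e : R) (w : O) (L : leaf R d) :
  tracks sim th mr N0 inI (T w) L ->
  ~ noisy e (addr L) (size (dataI L)) w ->
  `|noise_sum sim L| <= e * (size (dataI L))%:R.
Proof.
move=> [szL LE] nn; rewrite leNgt; apply/negP => big; apply: nn.
have dE : dataI L = map (labelled sim (T w)) (data_at (addr L) (size (dataI L)) w).
  by rewrite {1}LE.
split; first by rewrite -(size_map (labelled sim (T w))) -dE.
apply: lt_le_trans big _; rewrite le_eqVlt; apply/orP; left; apply/eqP; congr `|_|.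
rewrite /noise_sum /noise_total {1}dE big_map; apply: eq_bigr => p _.
by rewrite /labelled /response /= addrAC subrr add0r.
Qed.

(* Halving the exponent leaves a factor that is summable over [k]. *)
Lemma noisy_bigcup_outer_le (e : R) (h1 h2 K : nat) : 0 < e -> (0 < h1)%N ->
  let u := beta th * (e ^+ 2 / (2 * c) / 2) in
  0 < u -> 3 <= u * K%:R ->
  (forall h, (h1 <= h <= h2)%N -> (K * h <= fbal th h.-1)%N) ->
  outer_le P
    [set w | exists a k, [/\ (h1 <= size a <= h2)%N, (k < fbal th (size a))%N,
       beta th * (fbal th (size a).-1)%:R <= k%:R & noisy e a k w]]
    (2 / (1 - expR (- (e ^+ 2 / (2 * c) / 2))) * (2 * 2^-1 ^+ h1)).
Proof.
move=> e0 h10 u u0 uK fK; set rho := e ^+ 2 / (2 * c).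
have rho0 : 0 < rho by rewrite /rho divr_gt0 ?exprn_gt0// mulr_gt0.
set D := 2 / _.
have D0 : 0 <= D.
  by rewrite /D divr_ge0// subr_ge0 expR_le1; lra.
pose ks h := [seq k <- iota 0 (fbal th h) | beta th * (fbal th h.-1)%:R <= k%:R].
pose E h := \bigcup_(a in [set` enum {: h.-tuple bool}])
  \bigcup_(k in [set` ks h]) noisy e a k.
apply: (@outer_le_sub _ _ _ _ _ (\bigcup_(h in [set` iota h1 (h2.+1 - h1)]) E h)).
  move=> w [a [k [sa kf kb nw]]].
  exists (size a); first by rewrite /= mem_iota; lia.
  exists (in_tuple a); first by rewrite /= mem_enum.
  by exists k; rewrite //= mem_filter kb mem_iota.
apply: (@outer_le_ub _ _ _ _ _ (\sum_(h <- iota h1 (h2.+1 - h1)) D * 2^-1 ^+ h)).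
  by rewrite -mulr_sumr ler_wpM2l// half_pow_tail_le.
apply: outer_le_bigcup => h; rewrite mem_iota => hh.
have hh' : (h1 <= h <= h2)%N by lia.
set t := beta th * (fbal th h.-1)%:R.
apply: (@outer_le_ub _ _ _ _ _ (\sum_(a <- enum {: h.-tuple bool})
    (2 * \sum_(k < fbal th h | t <= k%:R) expR (- (k%:R * rho))))); last first.
  apply: outer_le_bigcup => a _.
  apply: (@outer_le_ub _ _ _ _ _ (\sum_(k <- ks h) 2 * expR (- (k%:R * rho)))).
    by rewrite -mulr_sumr big_filter -(big_mkord (fun k => t <= k%:R)
      (fun k => expR (- (k%:R * rho)))) /index_iota subn0.
  by apply: outer_le_bigcup => k _; exact: noisy_outer_le.
rewrite big_enum sumr_const -[X in X <= _]mulr_natl card_tuple card_bool natrX.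
have S := exp_tail_sum_le t (fbal th h) rho0.
(* The constant [3] serves here: [e^3 >= 1 + 3] gives [e^(-3h) <= 4^-h], which against the [2 ^ h]
   addresses of depth [h] leaves the summable [2^-h]. *)
have exp_le : expR (- (t * (rho / 2))) <= (2^-1 ^+ 2) ^+ h.
  have -> : t * (rho / 2) = u * (fbal th h.-1)%:R by rewrite /t /u -/rho; ring.
  have b1 : 3 * h%:R <= u * (fbal th h.-1)%:R.
    apply: le_trans (_ : u * K%:R * h%:R <= _).
      by rewrite ler_wpM2r.
    rewrite -mulrA; apply: ler_wpM2l; first exact: ltW.
    by rewrite -natrM ler_nat; exact: fK.
  apply: le_trans (_ : expR (- 3 * h%:R) <= _); first by rewrite ler_expR; lra.
  rewrite expRM_natr; apply: lerXn2r; rewrite ?nnegrE ?expR_ge0 ?exprn_ge0//.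
  rewrite expRN exprVn lef_pV2 ?posrE ?expR_gt0 ?exprn_gt0//.
  by apply: le_trans (expR_ge1Dx 3); lra.
apply: le_trans (_ : 2 ^+ h * (2 * (expR (- (t * (rho / 2))) / (1 - expR (- (rho / 2))))) <= _).
  by rewrite ler_wpM2l ?exprn_ge0// ler_wpM2l.
rewrite [X in X <= _](_ : _ = D * (2 ^+ h * expR (- (t * (rho / 2))))); last first.
  by rewrite /D; move: (_^-1) => iX; ring.
rewrite ler_wpM2l//.
apply: le_trans (_ : 2 ^+ h * (2^-1 ^+ 2) ^+ h <= _); first by rewrite ler_wpM2l ?exprn_ge0.
by rewrite -exprMn expr2 mulrA mulfV// mul1r.
Qed.

End Convergence.

(** Lets a shortage of hits at a deeper leaf be charged to depth [hmin]. *)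
Lemma hits_path_to_mono {R : realType} {d : nat} {dXi : measure_display}
    {Xi : measurableType dXi} {W : Type} (sim : simulator R d Xi) (th : tuning R)
    (mr : minimizer_rule R d) (N0 : nat) (inI : pred nat) (om : table R d Xi W)
    (xstar : vec R d) (j : 'I_d) (h c : nat) : (h <= c)%N ->
  (hits om j (path_to sim th mr N0 inI om xstar h) <=
   hits om j (path_to sim th mr N0 inI om xstar c))%N.
Proof.
elim: c => [|c IH]; first by rewrite leqn0 => /eqP ->.
rewrite leq_eqVlt => /orP[/eqP -> //|]; rewrite ltnS => /IH hc.
by rewrite [in X in (_ <= X)%N]/= hits_rcons; exact: leq_trans hc (leq_addr _ _).
Qed.

(** * Convergence in probability of the estimate *)

Theorem theorem5p3 (R : realType) (d : nat)
  (dXi : measure_display) (Xi : measurableType dXi) (Q : probability Xi R)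
  (sim : simulator R d Xi)
  (mean_meas : measurable_fun (@unit_cube R d) (mean_fun sim))
  (noise_meas : measurable_fun (@unit_cube R d `*` setT)
                  (fun p : vec R d * Xi => noise sim p.1 p.2))
  (noise_centered : forall x, unit_cube x ->
     Q.-integrable setT (EFin \o noise sim x) /\ ('E_Q[noise sim x] = 0)%E)
  (sub_gaussian : exists Csg : R, forall (x : vec R d) (lambda : R),
     unit_cube x ->
     ('E_Q[(fun xi => expR (lambda * noise sim x xi))]
        <= (expR (lambda ^+ 2 * Csg ^+ 2 / 2))%:E)%E)
  (xstar : vec R d)
  (unique_max : maximizers (mean_fun sim) = [set xstar])
  (lipschitz_at_max : exists2 C : R, 0 < C & forall x, unit_cube x ->
     mean_fun sim xstar - mean_fun sim x <= C * euclid_dist x xstar)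
  (well_separated : forall e : R, 0 < e -> exists2 delta : R, 0 < delta &
     forall x, unit_cube x -> e <= euclid_dist x xstar ->
       mean_fun sim x < mean_fun sim xstar - delta)
  (th : tuning R) (th_valid : valid_tuning th)
  (fbal_nondecreasing : {homo fbal th : c c' / (c <= c')%N})
  (mr : minimizer_rule R d)
  (mr_correct : minimizer_rule_correct th mr)
  (mr_meas : minimizer_rule_measurable mr)
  (dW : measure_display) (W : measurableType dW)
  (strat : nat -> strategy R d W)
  (strat_ok : forall N, chooses_current_leaf (strat N))
  (N0 : nat -> nat) (N0_lt : \forall N \near \oo, (N0 N < N)%N)
  (inI : nat -> pred nat)
  (inI_half : forall N, count (inI N) (iota 0 (N0 N)) = ((N0 N)./2)%N)
  (dO : measure_display) (O : measurableType dO) (P : probability O R)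
  (T : O -> table R d Xi W) (T_law : random_table P Q (kappa th) T) :
  let run (N : nat) (w : O) :=
    regular_tree_search sim th mr (T w) N (N0 N) (inI N) (strat N) in
  let estimate (N : nat) (w : O) := output_estimate (run N w) in
  forall
  (run_meas : forall N, measurable [set w | isSome (run N w)])
  (run_defined : P [set w | isSome (run N w)] @[N --> \oo] --> 1%E)
  (estimate_meas : forall N, measurable_fun setT (estimate N))
  (hmin hmax : nat -> nat)
  (depth_bounds : forall N, {ae P, forall w st, run N w = Some st ->
     all (fun L => hmin N <= depth L <= hmax N)%N (leaves st)})
  (hmin_infty : hmin N @[N --> \oo] --> \oo)
  (ratio_to_0 : ((hmax N)%:R / (fbal th (hmin N))%:R : R) @[N --> \oo] --> 0),
  cvg_in_probability P (fun N w => estimate N w - mean_fun sim xstar) 0.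
Proof.
move=> run estimate run_meas run_defined estimate_meas hmin hmax depth_bounds
  hmin_infty ratio_to_0 e e0.
have [Csg sg] := sub_gaussian.
(* A strictly positive variance proxy, as [Csg] may vanish and the deviation bounds divide by
   [c]. *)
pose c := Csg ^+ 2 + 1.
have c0 : 0 < c by rewrite /c ltr_wpDl ?sqr_ge0.
have sgc (x : vec R d) (lambda : R) : unit_cube x ->
    ('E_Q[(fun xi => expR (lambda * noise sim x xi))]
       <= (expR (lambda ^+ 2 * c / 2))%:E)%E.
  move=> x01; apply: le_trans (sg x lambda x01) _.
  rewrite lee_fin ler_expR /c.
  by have := sqr_ge0 lambda; nra.
have [x01 xmax] : maximizers (mean_fun sim) xstar by rewrite unique_max.
have [C C0 lip] := lipschitz_at_max.
have unif01 w k j : 0 <= tnth (unif (T w) k) j <= 1.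
  by have [_ _ /(_ w k j)/andP[/ltW -> ->]] := T_law.
have [/andP[a0 a1] /andP[b0 b1] k01 f0] := th_valid.
(* Any table contains a direction, so ['I_d] is inhabited. *)
have d0 : (0 < d)%N by exact: leq_ltn_trans (ltn_ord (dir (T point) [::])).
have hinf K : \forall N \near \oo, (K <= hmin N)%N.
  by move/cvgnyPge: hmin_infty; apply.
have ratio K : \forall N \near \oo, (K * hmax N <= fbal th (hmin N))%N.
  have K0 : 0 < (K.+1%:R : R)^-1 by rewrite invr_gt0.
  move/cvgrPdist_le: ratio_to_0 => /(_ _ K0).
  apply: filterS => N; rewrite sub0r normrN ger0_norm ?divr_ge0//.
  rewrite ler_pdivrMr ?ltr0n// mulrC ler_pdivlMr// -natrM ler_nat mulnC.
  by apply: leq_trans; rewrite leq_mul2r leqnSn orbT.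
have defined_near (eps : R) : 0 < eps ->
    \forall N \near \oo, 1 - eps <= fine (P [set w | isSome (run N w)]).
  move=> eps0; have /fine_cvgP[_ /cvgrPdist_le/(_ _ eps0)] := run_defined.
  by apply: filterS => N /=; rewrite ler_norml => /andP[? ?]; lra.
have run_ok N w st : (N0 N < N)%N -> run N w = Some st ->
    [/\ state_ok sim th mr (N0 N) (inI N) (T w) xstar st,
      (\sum_(L <- leaves st) size (dataI L) <= N)%N & (N <= nsim st)%N].
  move=> /ltnW NN; apply: regular_tree_search_ok => //; exact: unif01.
have depth_in N w st : (forall st, run N w = Some st ->
      all (fun L => hmin N <= depth L <= hmax N)%N (leaves st)) ->
    run N w = Some st ->
    {in leaves st, forall L, (hmin N <= depth L <= hmax N)%N}.
  by move=> H /H/allP.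
have count : \forall N \near \oo, [/\ (hmin N <= hmax N)%N,
     (0 < hmin N -> 2 ^ hmin N <= N)%N &
     (N <= 3 * (2 ^ hmax N * fbal th (hmax N)) + 1)%N].
  have half0 : 0 < (2^-1 : R) by lra.
  near=> N.
  have NN : (N0 N < N)%N by near: N; exact: N0_lt.
  have Pdef : 1 - 2^-1 <= fine (P [set w | isSome (run N w)]).
    by near: N; exact: defined_near.
  have [B [mB PB sB]] := depth_bounds N.
  (* The claim is deterministic, so one good outcome is enough: the run is defined with probability
     at least [1/2] and the depth bounds fail only on a null set. *)
  have [w [st [rw dw]]] : exists w st, run N w = Some st /\
      {in leaves st, forall L, (hmin N <= depth L <= hmax N)%N}.
    apply: contrapT => none.
    have : (P [set w | isSome (run N w)] <= P B)%E.
      apply: le_measure; rewrite ?inE//.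
      move=> w; rewrite /=; case E : (run N w) => [st|//] _.
      apply: sB => /= H; apply: none; exists w, st; split=> //.
      exact: depth_in H E.
    rewrite PB -(fineK (fin_num_measure P _ (run_meas N))) lee_fin; lra.
  have [ok sN nN] := run_ok N w st NN rw.
  exact: (state_counts th_valid fbal_nondecreasing ok sN nN dw).
have growth := slow_depth_growth fbal_nondecreasing count ratio hinf.
(* Noise and bias contribute [e1] each, for a total of [e / 2 < e]. *)
pose e1 := e / 4.
have e10 : 0 < e1 by rewrite /e1; lra.
pose rho := e1 ^+ 2 / (2 * c).
have rho0 : 0 < rho by rewrite /rho divr_gt0 ?exprn_gt0// mulr_gt0.
pose u := beta th * (rho / 2).
have u0 : 0 < u by rewrite /u mulr_gt0// divr_gt0.
pose K := Num.bound (3 / u).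
have uK : 3 <= u * K%:R.
  rewrite mulrC -ler_pdivrMr//; apply/ltW/archi_boundP.
  by rewrite divr_ge0// ltW.
(* [m] hits in every direction make the box on the path thin enough for a bias of at most [e1]. *)
have [m mP] : exists m, C * (d%:R * (1 - alpha th) ^+ m) <= e1.
  have q0 : 0 < C * d%:R by rewrite mulr_gt0// ltr0n.
  have [||m mP] := @pow_eventually_le R (1 - alpha th) (e1 / (C * d%:R)).
  - by apply/andP; split; lra.
  - by rewrite divr_gt0.
  exists m; have := mP m (leqnn m).
  by rewrite ler_pdivlMr// mulrC mulrA.
pose D := 2 / (1 - expR (- (rho / 2))).
have D0 : 0 < D.
  by rewrite /D divr_gt0// subr_gt0 expR_lt1; lra.
pose r := 1 - kappa th / d%:R / 2.
have r01 : 0 <= r < 1.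
  have d1 : (1 : R) <= d%:R by rewrite ler1n.
  have /andP[k0 k1] := k01.
  have : 0 < kappa th / d%:R <= 1.
    by rewrite divr_gt0//= ?ltr0n// ler_pdivrMr ?ltr0n// mul1r; lra.
  by rewrite /r => /andP[? ?]; apply/andP; split; lra.
have mE N : measurable [set w | e <= `|estimate N w - mean_fun sim xstar - 0|].
  rewrite -[X in measurable X]setTI; apply: measurable_fun_le => //.
  by apply: measurableT_comp => //; do 2 apply: measurable_funB => //.
apply/fine_cvgP; split; first by apply: nearW => N; exact: fin_num_measure.
apply/cvgrPdist_le => eps eps0.
have eps3 : 0 < eps / 3 by lra.
have [h1 h1P] : exists h1, forall h, (h1 <= h)%N -> D * (2 * 2^-1 ^+ h) <= eps / 3.
  have D20 : 0 < D * 2 by exact: mulr_gt0.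
  have [||h1 h1P] := @pow_eventually_le R 2^-1 (eps / 3 / (D * 2)).
  - by apply/andP; split; lra.
  - by rewrite divr_gt0.
  exists h1 => h /h1P; rewrite ler_pdivlMr//.
  by rewrite mulrA [_ * (D * 2)]mulrC.
have [h2 h2P] : exists h2, forall h, (h2 <= h)%N ->
    d%:R * (2 ^+ m * r ^+ h) <= eps / 3.
  have p0 : (0 : R) < d%:R * 2 ^+ m by rewrite mulr_gt0 ?ltr0n// exprn_gt0.
  have [//||h2 h2P] := @pow_eventually_le R r (eps / 3 / (d%:R * 2 ^+ m)).
    by rewrite divr_gt0.
  exists h2 => h /h2P; rewrite ler_pdivlMr//.
  by rewrite mulrA [_ * (d%:R * _)]mulrC.
near=> N.
have NN : (N0 N < N)%N by near: N; exact: N0_lt.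
have hm0 : (0 < hmin N)%N by near: N; exact: hinf.
have hm1 : (h1 <= hmin N)%N by near: N; exact: hinf.
have hm2 : (h2 <= hmin N)%N by near: N; exact: hinf.
rewrite sub0r normrN ger0_norm ?fine_ge0//.
apply: outer_le_measurable => //.
have [B [mB PB sB]] := depth_bounds N.
pose X := [set w | exists a k, [/\ (hmin N <= size a <= hmax N)%N,
  (k < fbal th (size a))%N, beta th * (fbal th (size a).-1)%:R <= k%:R &
  noisy sim th mr (N0 N) (inI N) T e1 a k w]].
pose F := \bigcup_(j in [set` enum 'I_d])
  few_hits sim th mr (N0 N) (inI N) xstar T j (hmin N) m.
have undef_le : outer_le P (~` [set w | isSome (run N w)]) (eps / 3).
  exists (~` [set w | isSome (run N w)]); split=> //; first exact: measurableC.
  have : 1 - eps / 3 <= fine (P [set w | isSome (run N w)]).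
    by near: N; exact: defined_near.
  rewrite probability_setC// -(fineK (fin_num_measure P _ (run_meas N))) -EFinB lee_fin.
  by lra.
have B_le : outer_le P B 0 by exists B; split=> //; rewrite PB.
have X_le : outer_le P X (eps / 3).
  apply: (outer_le_ub (h1P (hmin N) hm1)).
  apply: (noisy_bigcup_outer_le mean_meas noise_meas c0 sgc mr_meas _ _ T_law
    (K := K)) => // h /andP[hh1 hh2].
  have gN : (K * hmin N <= fbal th (hmin N).-1)%N by near: N; exact: growth.
  have rN : (K * hmax N <= fbal th (hmin N))%N by near: N; exact: ratio.
  (* At [h = hmin N] the growth bound applies directly; for larger [h], [f (h - 1) >= f (hmin N) >=
     K hmax N >= K h]. *)
  move: hh1; rewrite leq_eqVlt => /orP[/eqP <-//|hh1].
  apply: leq_trans (_ : K * hmax N <= _)%N; first by rewrite leq_mul2l hh2 orbT.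
  apply: leq_trans rN _; apply: fbal_nondecreasing.
  by case: h hh1 {hh2}.
have F_le : outer_le P F (eps / 3).
  apply: (outer_le_ub (h2P (hmin N) hm2)).
  have -> : d%:R * (2 ^+ m * r ^+ hmin N) = \sum_(j <- enum 'I_d) 2 ^+ m * r ^+ hmin N.
    by rewrite big_enum sumr_const card_ord mulr_natl.
  apply: outer_le_bigcup => j _.
  have mF := few_hits_measurable th mean_meas noise_meas mr_meas (N0 N) (inI N)
    xstar T_law j (hmin N) m.
  eexists; split; [exact: mF| |by []].
  rewrite -(fineK (fin_num_measure P _ mF)) lee_fin.
  exact: (few_hits_bound th mean_meas noise_meas mr_meas (N0 N) (inI N) xstar T_law).
have -> : eps = eps / 3 + 0 + eps / 3 + eps / 3 by lra.
apply: outer_le_sub (outer_leU (outer_leU (outer_leU undef_le B_le) X_le) F_le).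
(* The four exceptional events are an undefined run, violated depth bounds, a noisy node and too few
   hits on the path. Outside them the error is at most [2 e1]. *)
move=> w /= big; apply: contrapT => /not_orP[/not_orP[/not_orP[def nB] nX] nF].
move/contrapT: def; rewrite /=; case E : (run N w) => [st|//] _.
have dw : {in leaves st, forall L, (hmin N <= depth L <= hmax N)%N}.
  apply: depth_in E; apply: contrapT => H; apply: nB; exact: sB.
have [ok _ _] := run_ok N w st NN E; have [g _ _ _ _] := ok.
have : `|output_estimate (Some st) - mean_fun sim xstar| <=
    e1 + C * (d%:R * (1 - alpha th) ^+ m).
  apply: (estimate_close th_valid _ ok) => //.
  - by move=> L /dw/andP[+ _]; exact: leq_trans.
  - exact: ltW.
  - move=> L Ls; have [tL sL fL nL] := g L Ls.
    apply: (noise_sum_noisy tL) => nn; apply: nX.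
    exists (addr L), (size (dataI L)); split=> //; first exact: dw.
    apply: fL; rewrite prednK//; have /andP[+ _] := dw L Ls; exact: leq_trans.
  - move=> L Ls Lp j; have [_ _ _ nL] := g L Ls.
    apply: le_trans (nL j) _; apply: ler_wiXn2l; [lra|lra|].
    rewrite (eqP Lp); have /andP[hL _] := dw L Ls.
    apply: leq_trans (hits_path_to_mono _ _ _ _ _ _ _ _ hL).
    rewrite leqNgt; apply/negP => few; apply: nF.
    by exists j; rewrite //= mem_enum.
move: big; rewrite /estimate E subr0 => big close.
have : e <= e1 + e1 by apply: le_trans big _; apply: le_trans close _; rewrite lerD2l.
by rewrite /e1; lra.
Unshelve. all: by end_near. Qed.
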